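(* Suppose $n\le m$. Let $\mu=\mathcal{N}(m_0,\Sigma_0)$ and $\nu=\mathcal{N}(m_1,\Sigma_1)$ be two Gaussian measures on $\mathbb{R}^m$ and $\mathbb{R}^n$ respectively. Let $\Sigma_0=P_0D_0P_0^T$ and $\Sigma_1=P_1D_1P_1^T$ be diagonalizations ($P_0,P_1$ orthogonal, $D_0,D_1$ diagonal) which sort the eigenvalues in decreasing order. Suppose that $\Sigma_0$ is non-singular. Then the problem $$GGW_2^2(\mu,\nu)=\inf_{\pi\in\Pi(\mu,\nu)\cap\mathcal{N}_{m+n}}\int\int\left(\|x-x'\|_{\mathbb{R}^m}^2-\|y-y'\|_{\mathbb{R}^n}^2\right)^2d\pi(x,y)\,d\pi(x',y')$$ admits a solution of the form $\pi^*=(I_m,T)\#\mu$ with $T$ affine of the form $$\forall x\in\mathbb{R}^m,\quad T(x)=m_1+P_1AP_0^T(x-m_0),$$ where $A\in\mathbb{R}^{n\times m}$ is $$A=\begin{pmatrix}\tilde I_nD_1^{1/2}(D_0^{(n)})^{-1/2} & 0_{n,m-n}\end{pmatrix},$$ with $\tilde I_n$ any matrix of the form $\mathrm{diag}((\pm1)_{i\le n})$. Moreover $$GGW_2^2(\mu,\nu)=4\left(\mathrm{tr}(D_0)-\mathrm{tr}(D_1)\right)^2+8\|D_0^{(n)}-D_1\|_{\mathcal{F}}^2+8\left(\|D_0\|_{\mathcal{F}}^2-\|D_0^{(n)}\|_{\mathcal{F}}^2\right).$$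
   Context: $\Pi(\mu,\nu)$ is the set of probability measures on $\mathbb{R}^m\times\mathbb{R}^n$ with marginals $\mu$ and $\nu$; $\mathcal{N}_{m+n}$ is the set of Gaussian measures on $\mathbb{R}^{m+n}$ (degenerate ones, i.e. with singular covariance, included). $(I_m,T)\#\mu$ is the push-forward of $\mu$ by $x\mapsto(x,T(x))$. $\|\cdot\|_{\mathbb{R}^d}$ is the Euclidean norm; $\|M\|_{\mathcal{F}}=\sqrt{\mathrm{tr}(M^TM)}$ is the Frobenius norm. For $B\in\mathbb{R}^{m\times m}$, $B^{(n)}\in\mathbb{R}^{n\times n}$ is the submatrix of the first $n$ rows and first $n$ columns. $0_{p,q}$ is the $p\times q$ zero matrix. $M^{1/2}$ is the positive semi-definite square root of a positive semi-definite $M$. ''Decreasing'' means non-increasing. *)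

(* Defs.v *)
From HB Require Import structures.
From mathcomp Require Import all_boot all_order all_algebra.
From mathcomp Require Import all_classical all_reals all_analysis.

Set Implicit Arguments.
Unset Strict Implicit.
Unset Printing Implicit Defensive.

Import Order.TTheory GRing.Theory Num.Theory.
Import numFieldNormedType.Exports.

Local Open Scope classical_set_scope.
Local Open Scope ring_scope.

(* Matrices (in particular the column vectors 'cV[R]_d = R^d) carry their Borel
   sigma-algebra; R^m x R^n is the product type with the product
   sigma-algebra. *)
HB.instance Definition _ (R : realType) (p q : nat) :=
  @isMeasurable.Build (sigma_display (@open 'M[R]_(p, q))) 'M[R]_(p, q)
    <<s @open 'M[R]_(p, q) >>
    (@sigma_algebra0 _ setT _) (@sigma_algebraC _ _) (@sigma_algebra_bigcup _ setT _).

Section linear_algebra.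
Variable R : realType.

Definition dotp d (x y : 'cV[R]_d) : R := \sum_i x i ord0 * y i ord0.

Definition enorm d (x : 'cV[R]_d) : R := Num.sqrt (dotp x x).

Definition frobenius p q (M : 'M[R]_(p, q)) : R := Num.sqrt (\tr (M^T *m M)).

Definition psdmx d (S : 'M[R]_d) : Prop :=
  S^T = S /\ forall x : 'cV[R]_d, 0 <= dotp x (S *m x).

(* The positive semi-definite square root; 0 if M has none, that is, if M is
   not positive semi-definite. *)
Definition sqrtmx d (M : 'M[R]_d) : 'M[R]_d :=
  xget 0 [set S | psdmx S /\ S *m S = M].

Definition orthogonalmx d (P : 'M[R]_d) : Prop := P^T *m P = 1%:M.

Definition sorted_diagonalization d (S P D : 'M[R]_d) : Prop :=
  [/\ orthogonalmx P, is_diag_mx D,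
      forall i j : 'I_d, (i <= j)%N -> D j j <= D i i &
      S = P *m D *m P^T].

Definition leading m n (hnm : (n <= m)%N) (B : 'M[R]_m) : 'M[R]_n :=
  mxsub (widen_ord hnm) (widen_ord hnm) B.

Definition signmx n (eps : 'I_n -> bool) : 'M[R]_n :=
  diag_mx (\row_i (-1) ^+ eps i).

Definition gw_matrix m n (hnm : (n <= m)%N) (eps : 'I_n -> bool)
    (D0 : 'M[R]_m) (D1 : 'M[R]_n) : 'M[R]_(n, m) :=
  castmx (erefl n, subnKC hnm)
    (row_mx (signmx eps *m sqrtmx D1 *m invmx (sqrtmx (leading hnm D0)))
            (0 : 'M[R]_(n, m - n))).

End linear_algebra.

Section gaussian.
Variable R : realType.

(* The Gaussian law on the line with mean a and variance v >= 0. The case v = 0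
   is separate because the library's normal_prob a 0 is not the Dirac mass
   at a. *)
Definition gaussian1 (a v : R) (B : set (measurableTypeR R)) : \bar R :=
  if v == 0 then \d_(a : measurableTypeR R) B else normal_prob a (Num.sqrt v) B.

(* P = N(a, S), S possibly singular: every linear form <t, .> has under P the
   law N(<t, a>, <t, S t>). *)
Definition is_gaussian d (P : set 'cV[R]_d -> \bar R)
    (a : 'cV[R]_d) (S : 'M[R]_d) : Prop :=
  psdmx S /\
  forall (t : 'cV[R]_d) (B : set (measurableTypeR R)), measurable B ->
    pushforward P (dotp t : 'cV[R]_d -> measurableTypeR R) B =
    gaussian1 (dotp t a) (dotp t (S *m t)) B.

End gaussian.

Section gromov_wasserstein.
Variables (R : realType) (m n : nat).
Implicit Types (mu : probability 'cV[R]_m R) (nu : probability 'cV[R]_n R).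
Implicit Types pi : probability ('cV[R]_m * 'cV[R]_n)%type R.

Definition couplings mu nu : set (probability ('cV[R]_m * 'cV[R]_n)%type R) :=
  [set pi | (forall A, measurable A -> pushforward pi fst A = mu A) /\
            (forall B, measurable B -> pushforward pi snd B = nu B)].

(* R^m x R^n is identified with R^(m + n) by stacking the two vectors. *)
Definition gaussians : set (probability ('cV[R]_m * 'cV[R]_n)%type R) :=
  [set pi | exists a S, is_gaussian
    (pushforward pi (fun z => col_mx z.1 z.2 : 'cV[R]_(m + n))) a S].

Definition gw_cost pi : \bar R :=
  (\int[pi]_z \int[pi]_z'
     ((enorm (z.1 - z'.1) ^+ 2 - enorm (z.2 - z'.2) ^+ 2) ^+ 2)%:E)%E.

(* The value GGW_2^2 of the problem, not its square root. *)
Definition GGW2_sq mu nu : \bar R :=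
  ereal_inf [set gw_cost pi | pi in couplings mu nu `&` gaussians].

End gromov_wasserstein.

(* Main.v *)
Require Import Defs.
From HB Require Import structures.
From mathcomp Require Import all_boot all_order all_algebra.
From mathcomp Require Import all_classical all_reals all_analysis.
From mathcomp Require Import measurable_realfun.
From mathcomp Require Import ring lra.

Set Implicit Arguments.
Unset Strict Implicit.
Unset Printing Implicit Defensive.

Import Order.TTheory GRing.Theory Num.Theory.
Import numFieldNormedType.Exports.

Local Open Scope classical_set_scope.
Local Open Scope ring_scope.

(** The transport problem splits into a finite-dimensional optimization and a
    measure-theoretic part.

    Let a Gaussian coupling have joint covariance S, with diagonal blocks Sigma0
    and Sigma1 and off-diagonal block K. For z and z' independent with this law,
    W = z - z' is centred Gaussian with covariance 2 S, and the integrand is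
    (sum_i e_i W_i^2)^2 with e_i = 1 on the first m coordinates and -1 on the
    others. So the cost is a sum of moments E[W_i^2 W_j^2] = 4 S_ii S_jj + 8 S_ij^2
    ([has_int2_gaussian_sqr2]), that is ([gw_cost_gaussian])
      4 (tr Sigma0 - tr Sigma1)^2
        + 8 (|Sigma0|^2 + |Sigma1|^2 - 2 |K|^2)     (Frobenius norms).
    Only K is free, and |K|^2 has to be maximized over the K for which S is
    positive semi-definite. These moments come from one-dimensional laws alone:
    by polarization x^2 y^2 is a combination of fourth powers of x, y, x + y and
    x - y, and E[<t, W>^4] only involves the law of <t, z>.

    Rotating by P0 and P1 makes the diagonal blocks equal to D0 and D1, with
    decreasing diagonals lam and mu. Testing positivity of S on well chosen
    vectors gives sum_i K_ij^2 / lam_i <= mu_j and sum_j K_ij^2 / mu_j <= lam_i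
    ([schur_diag]). Hence s_ij = K_ij^2 / (lam_i mu_j) is doubly substochastic,
    and the rearrangement inequality ([substochastic_rearrangement]) gives
    |K|^2 = sum_ij lam_i mu_j s_ij <= sum_k lam_k mu_k ([block_bound]). The map T
    of the statement yields, after this rotation, K_kk = +- sqrt (lam_k mu_k)
    and 0 elsewhere, so it attains this bound ([gw_matrix_entries]).

    It remains to see that T transports mu to nu. Every linear image of T#mu has
    the same Gaussian law as the corresponding image of nu, and the theorem of
    Cramer and Wold ([cramer_wold]) says that the one-dimensional projections of
    a probability measure determine it. *)

(** * Dot products and quadratic forms *)

Section dot_product.
Context {R : realType}.

Lemma dotpC d (x y : 'cV[R]_d) : dotp x y = dotp y x.
Proof. by apply: eq_bigr => i _; rewrite mulrC. Qed.

Lemma dotpDl d (s t x : 'cV[R]_d) : dotp (s + t) x = dotp s x + dotp t x.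
Proof. by rewrite /dotp -big_split; apply: eq_bigr => i _; rewrite mxE mulrDl. Qed.

Lemma dotpZl d a (t x : 'cV[R]_d) : dotp (a *: t) x = a * dotp t x.
Proof. by rewrite /dotp big_distrr; apply: eq_bigr => i _; rewrite mxE /= mulrA. Qed.

Lemma dotpNl d (t x : 'cV[R]_d) : dotp (- t) x = - dotp t x.
Proof. by rewrite -scaleN1r dotpZl mulN1r. Qed.

Lemma dotp0l d (x : 'cV[R]_d) : dotp 0 x = 0.
Proof. by rewrite -(scale0r 0) dotpZl mul0r. Qed.

Lemma dotpDr d (x y z : 'cV[R]_d) : dotp x (y + z) = dotp x y + dotp x z.
Proof. by rewrite dotpC dotpDl !(dotpC x). Qed.

Lemma dotpZr d a (x y : 'cV[R]_d) : dotp x (a *: y) = a * dotp x y.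
Proof. by rewrite dotpC dotpZl (dotpC x). Qed.

Lemma dotpNr d (x y : 'cV[R]_d) : dotp x (- y) = - dotp x y.
Proof. by rewrite dotpC dotpNl (dotpC x). Qed.

Lemma dotp0r d (x : 'cV[R]_d) : dotp x 0 = 0.
Proof. by rewrite dotpC dotp0l. Qed.

Lemma dotpE d (x y : 'cV[R]_d) : dotp x y = (x^T *m y) ord0 ord0.
Proof. by rewrite mxE; apply: eq_bigr => i _; rewrite mxE. Qed.

Lemma dotp_mulmx p q (L : 'M[R]_(p, q)) (t : 'cV[R]_p) (x : 'cV[R]_q) :
  dotp t (L *m x) = dotp (L^T *m t) x.
Proof. by rewrite !dotpE trmx_mul trmxK mulmxA. Qed.

Lemma dotp_col_mx p q (s x : 'cV[R]_p) (t y : 'cV[R]_q) :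
  dotp (col_mx s t) (col_mx x y) = dotp s x + dotp t y.
Proof.
rewrite /dotp big_split_ord; congr (_ + _); apply: eq_bigr => i _.
  by rewrite !col_mxEu.
by rewrite !col_mxEd.
Qed.

Lemma dotp_delta d (i : 'I_d) (x : 'cV[R]_d) :
  dotp (delta_mx i ord0) x = x i ord0.
Proof.
rewrite /dotp (bigD1 i)//= mxE !eqxx mul1r big1 ?addr0// => j ji.
by rewrite mxE (negbTE ji) mul0r.
Qed.

Lemma dotp_ge0 d (x : 'cV[R]_d) : 0 <= dotp x x.
Proof. by apply: sumr_ge0 => i _; rewrite -expr2 sqr_ge0. Qed.

Lemma enorm_sqr d (x : 'cV[R]_d) : enorm x ^+ 2 = \sum_i x i ord0 ^+ 2.
Proof. by rewrite sqr_sqrtr ?dotp_ge0//; apply: eq_bigr => i _; rewrite expr2. Qed.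

Definition quad d (S : 'M[R]_d) (t : 'cV[R]_d) := dotp t (S *m t).

Lemma quad_delta d (S : 'M[R]_d) i j c : S^T = S ->
  quad S (delta_mx i ord0 + c *: delta_mx j ord0) =
  S i i + 2 * c * S i j + c ^+ 2 * S j j.
Proof.
move=> symS; have e k l : dotp (delta_mx k ord0) (S *m delta_mx l ord0) = S k l.
  by rewrite dotp_delta -colE mxE.
have Sji : S j i = S i j by rewrite -[in LHS]symS mxE.
rewrite /quad mulmxDr -scalemxAr !(dotpDl, dotpDr, dotpZl, dotpZr) !e Sji.
by ring.
Qed.

Lemma quad_delta1 d (S : 'M[R]_d) i : S^T = S -> quad S (delta_mx i ord0) = S i i.
Proof.
by move=> /(quad_delta i i 0); rewrite scale0r addr0 => ->; rewrite expr0n/=; ring.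
Qed.

(** Polarization: the form at e_i, e_j and e_i + e_j gives the entry (i, j). *)
Lemma quad_inj d (S U : 'M[R]_d) : S^T = S -> U^T = U -> quad S =1 quad U -> S = U.
Proof.
move=> symS symU SU; apply/matrixP => i j.
have := SU (delta_mx i ord0 + 1 *: delta_mx j ord0).
have := SU (delta_mx i ord0); have := SU (delta_mx j ord0).
by rewrite !quad_delta// !quad_delta1//; lra.
Qed.

Lemma quad_cong p q (L : 'M[R]_(p, q)) (S : 'M[R]_q) t :
  quad (L *m S *m L^T) t = quad S (L^T *m t).
Proof. by rewrite /quad -!mulmxA dotp_mulmx. Qed.

Lemma psdmx_cong p q (L : 'M[R]_(p, q)) (S : 'M[R]_q) :
  psdmx S -> psdmx (L *m S *m L^T).
Proof.
move=> [symS posS]; split; first by rewrite !trmx_mul trmxK symS mulmxA.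
by move=> x; rewrite -/(quad _ x) quad_cong; exact: posS.
Qed.

Lemma mxtrace_trmx_mul p q (M : 'M[R]_(p, q)) :
  \tr (M^T *m M) = \sum_i \sum_j M i j ^+ 2.
Proof.
rewrite exchange_big; apply: eq_bigr => j _; rewrite mxE; apply: eq_bigr => i _.
by rewrite mxE expr2.
Qed.

Lemma frobenius_sqr p q (M : 'M[R]_(p, q)) :
  frobenius M ^+ 2 = \sum_i \sum_j M i j ^+ 2.
Proof.
rewrite /frobenius sqr_sqrtr mxtrace_trmx_mul//.
by apply: sumr_ge0 => i _; apply: sumr_ge0 => j _; exact: sqr_ge0.
Qed.

Lemma frobenius_tr p q (M : 'M[R]_(p, q)) : frobenius M ^+ 2 = \tr (M^T *m M).
Proof. by rewrite frobenius_sqr mxtrace_trmx_mul. Qed.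

End dot_product.

(** * The Borel sigma-algebra of matrices *)

Section borel_matrices.
Context {R : realType}.

Lemma measurable_coord p q (i : 'I_p) (j : 'I_q) :
  measurable_fun setT (fun M : 'M[R]_(p, q) => M i j : measurableTypeR R).
Proof.
apply: (measurability _ (RGenOInfty.measurableE R)) => //.
move=> _ [_ [a ->] <-]; rewrite setTI.
apply: sub_sigma_algebra => /=.
apply: open_comp; last exact: interval_open.
by move=> M _; apply: coord_continuous.
Qed.

(** An open set of matrices is a countable union of boxes with rational centres and
    radii 1 / (k + 1), and the preimage of a box is controlled by the coordinates. *)
Lemma measurable_mx d (T : measurableType d) p q (f : T -> 'M[R]_(p, q)) :
  (forall i j, measurable_fun setT (fun x => f x i j : measurableTypeR R)) ->
  measurable_fun setT f.
Proof.
move=> mf; apply: (@measurability _ _ _ _ setT f (@open 'M[R]_(p, q))) => //.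
move=> _ [U oU <-]; rewrite setTI.
pose box (c : 'M[rat]_(p, q)) (k : nat) : set 'M[R]_(p, q) :=
  [set M | forall i j, `|ratr (c i j) - M i j| < k.+1%:R^-1].
have mbox c k : measurable (f @^-1` box c k).
  have -> : f @^-1` box c k = \bigcap_i \bigcap_j
      ((fun x => f x i j : measurableTypeR R) @^-1` ball (ratr (c i j) : R) k.+1%:R^-1).
    by apply/seteqP; split=> [x h i _ j _|x h i j]; [exact: h|exact: h].
  apply: fin_bigcap_measurable; first exact: finite_finset.
  move=> i _; apply: fin_bigcap_measurable; first exact: finite_finset.
  move=> j _; rewrite -[X in measurable X]setTI; apply: mf => //.
  exact: measurable_ball.
have -> : f @^-1` U = \bigcup_c \bigcup_(k in [set k | box c k `<=` U])
    (f @^-1` box c k).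
  apply/seteqP; split=> [x Ux|x [c _ [k /= sU]]]; last exact: sU.
  have /nbhs_ballP[e /= e0 eU] : nbhs (f x) U by apply: open_nbhs_nbhs.
  have [k _ ke] : exists2 k : nat, True & k.+1%:R^-1 < e / 2.
    have /ltr_add_invr[k] : 0 < e / 2 by rewrite divr_gt0.
    by rewrite add0r; exists k.
  have cP i j : exists r : rat, `|ratr r - f x i j| < k.+1%:R^-1.
    have /rat_in_itvoo[r] : f x i j - k.+1%:R^-1 < f x i j + k.+1%:R^-1.
      by rewrite ltrD2l gtrN// invr_gt0.
    by rewrite in_itv/= => r12; exists r; rewrite ltr_distl.
  pose c : 'M[rat]_(p, q) := \matrix_(i, j) projT1 (cid (cP i j)).
  exists c => //; exists k => /=.
    move=> M hM; apply: eU; split => // i j.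
    rewrite /ball/= -(subrK (ratr (c i j)) (f x i j)) -addrA.
    rewrite (le_lt_trans (ler_normD _ _))// [ltRHS]splitr ltrD//.
      rewrite distrC mxE; case: cid => r /= hr; exact: lt_trans ke.
    by rewrite (lt_trans _ ke).
  by move=> i j; rewrite mxE; case: cid.
apply: countable_bigcupT_measurable => [|c]; first exact: countableP.
by apply: bigcup_measurable => k _.
Qed.

Lemma measurable_dotp d (t : 'cV[R]_d) :
  measurable_fun setT (dotp t : 'cV[R]_d -> measurableTypeR R).
Proof.
apply: measurable_sum => i; apply: measurable_funM => //.
exact: measurable_coord.
Qed.

Lemma measurable_mulmx p q r (L : 'M[R]_(p, q)) :
  measurable_fun setT (mulmx L : 'M[R]_(q, r) -> 'M[R]_(p, r)).
Proof.
apply: measurable_mx => i j.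
under eq_fun do rewrite mxE.
apply: measurable_sum => k; apply: measurable_funM => //.
exact: measurable_coord.
Qed.

Lemma measurable_mxD d (T : measurableType d) p q (f g : T -> 'M[R]_(p, q)) :
  measurable_fun setT f -> measurable_fun setT g ->
  measurable_fun setT (fun x => f x + g x).
Proof.
move=> mf mg; apply: measurable_mx => i j.
under eq_fun do rewrite mxE.
by apply: measurable_funD; apply: (measurableT_comp (measurable_coord i j)).
Qed.

Lemma measurable_col_mx p q : measurable_fun setT
  (fun z : 'cV[R]_p * 'cV[R]_q => col_mx z.1 z.2 : 'cV[R]_(p + q)).
Proof.
apply: measurable_mx => i j.
rewrite -(splitK i); case: (fintype.split i) => k /=.
  under eq_fun do rewrite col_mxEu.
  by apply: (measurableT_comp (measurable_coord k j)).
under eq_fun do rewrite col_mxEd.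
by apply: (measurableT_comp (measurable_coord k j)).
Qed.

(** The encoding by lists makes the family a pi-system by concatenation, and allows
    a statement on it to be proved one half-space at a time. *)
Definition halfspaces d (s : seq ('cV[R]_d * R)) : set 'cV[R]_d :=
  [set x | forall p, p \in s -> dotp p.1 x < p.2].

Lemma measurable_halfspace d (t : 'cV[R]_d) a : measurable [set x | dotp t x < a].
Proof.
rewrite -[X in measurable X]setTI.
have -> : [set x | dotp t x < a] =
    (dotp t : 'cV[R]_d -> measurableTypeR R) @^-1` `]-oo, a[.
  by apply/seteqP; split=> x /=; rewrite in_itv.
by apply: measurable_dotp => //; exact: measurable_itv.
Qed.

Lemma halfspaces_cons d p (s : seq ('cV[R]_d * R)) :
  halfspaces (p :: s) = [set x | dotp p.1 x < p.2] `&` halfspaces s.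
Proof.
apply/seteqP; split=> x /=.
  move=> h; split; first by apply: h; rewrite mem_head.
  by move=> q qs; apply: h; rewrite in_cons qs orbT.
by move=> [h1 h2] q; rewrite in_cons => /predU1P[->//|]; exact: h2.
Qed.

Lemma measurable_halfspaces d (s : seq ('cV[R]_d * R)) : measurable (halfspaces s).
Proof.
elim: s => [|p s ih]; last first.
  by rewrite halfspaces_cons; apply: measurableI => //; exact: measurable_halfspace.
by rewrite (_ : halfspaces _ = setT)//; apply/seteqP; split.
Qed.

(** The coordinates are measurable for the sigma-algebra generated by the
    half-spaces, hence so is the identity, by [measurable_mx]. *)
Lemma borel_halfspaces d :
  (measurable : set (set 'cV[R]_d)) = <<s range (@halfspaces d) >>.
Proof.
apply/seteqP; split; last first.
  apply: smallest_sub; first exact: sigma_algebra_measurable.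
  by move=> _ [s _ <-]; exact: measurable_halfspaces.
move=> A mA.
pose G := range (@halfspaces d).
(* The identity, from this smaller sigma-algebra to the Borel one. *)
suff mid : measurable_fun setT (id : g_sigma_algebraType G -> 'cV[R]_d).
  by have := mid measurableT _ mA; rewrite setTI.
apply: measurable_mx => i j; rewrite (ord1 j).
apply: (measurability _ (RGenInftyO.measurableE R)) => //.
move=> _ [_ [a ->] <-]; rewrite setTI.
apply: sub_sigma_algebra; exists [:: (delta_mx i ord0, a)] => //.
apply/seteqP; split=> x /=; rewrite in_itv/=.
  by move=> /(_ _ (mem_head _ _)); rewrite dotp_delta.
by move=> h p; rewrite inE => /eqP ->; rewrite dotp_delta.
Qed.

End borel_matrices.

(** * The theorem of Cramer and Wold *)

Section threshold_polynomials.
Context {R : realType}.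
Implicit Types (a q u : R) (n : nat).

Lemma bernoulli_ge n a : -1 <= a -> 1 + n%:R * a <= (1 + a) ^+ n.
Proof.
move=> a1; elim: n => [|n ih]; first by rewrite mul0r addr0 expr0.
have a10 : 0 <= 1 + a by lra.
rewrite exprS; apply: le_trans (ler_wpM2l a10 ih).
rewrite -natr1; have : 0 <= n%:R * (a * a) by rewrite mulr_ge0// -expr2 sqr_ge0.
lra.
Qed.

Lemma cvg_natmul_geometric q : 0 <= q < 1 -> n%:R * q ^+ n @[n --> \oo] --> (0 : R).
Proof.
move=> /andP[q0 q1].
have [->|qn0] := eqVneq q 0.
  apply: cvg_near_cst; near=> n; rewrite expr0n gtn_eqF ?mulr0//.
  by near: n; exists 1%N.
have {qn0}q0 : 0 < q by rewrite lt_def qn0.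
(* n q^n = (n r^n) r^n, and n r^n is bounded by Bernoulli's inequality. *)
pose r := Num.sqrt q.
have r0 : 0 < r by rewrite sqrtr_gt0.
have r1 : r < 1 by rewrite -[ltRHS]sqrtr1 ltr_sqrt.
have rr : q = r * r by rewrite -expr2 sqr_sqrtr// ltW.
pose h := r^-1 - 1.
have h0 : 0 < h by rewrite subr_gt0 invf_gt1.
have nr n : n%:R * r ^+ n <= h^-1.
  have : 1 + n%:R * h <= (1 + h) ^+ n by apply: bernoulli_ge; lra.
  rewrite (_ : 1 + h = r^-1); last by rewrite /h; ring.
  rewrite exprVn => hn.
  rewrite -(ler_pM2r h0) mulVf ?gt_eqF//.
  rewrite -(ler_pM2r (_ : 0 < (r ^+ n)^-1)) ?invr_gt0 ?exprn_gt0// mul1r.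
  rewrite mulrAC mulfK ?expf_eq0 ?(gt_eqF r0) ?andbF//.
  by apply: le_trans hn; rewrite lerDr.
apply: (@squeeze_cvgr _ _ _ _ (fun=> 0) (fun n => h^-1 * r ^+ n)).
- near=> n; rewrite mulr_ge0 ?exprn_ge0 ?(ltW q0)//= rr exprMn mulrA.
  by rewrite ler_wpM2r ?exprn_ge0 ?(ltW r0).
- exact: cvg_cst.
- rewrite -[X in _ --> X](mulr0 h^-1); apply: cvgMr.
  by apply: cvg_expr; rewrite ger0_norm ?(ltW r0).
Unshelve. all: by end_near. Qed.

(** Polynomials in u that stay in [0, 1] and converge to a sharp threshold at 1/2.
    The exponent N = n 2^n is chosen so that N u^n = n (2 u)^n tends to 0 when
    u < 1/2 and is at least n when u >= 1/2, the endpoint included; Bernoulli's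
    inequality then bounds (1 - u^n)^N from below in the first case and, applied
    to (1 + u^n)^N, from above in the second. *)
Lemma cvg_threshold_polynomial u : 0 <= u <= 1 ->
  (1 - u ^+ n) ^+ (n * 2 ^ n)%N @[n --> \oo] --> (((u < 2^-1)%R)%:R : R).
Proof.
move=> /andP[u0 u1].
have un n : 0 <= u ^+ n <= 1 by rewrite exprn_ge0//= exprn_ile1.
have natE n : (n * 2 ^ n)%:R * u ^+ n = n%:R * (2 * u) ^+ n :> R.
  by rewrite natrM natrX exprMn mulrA.
have [uh|uh] := ltP u 2^-1.
  apply: (@squeeze_cvgr _ _ _ _ (fun n => 1 - n%:R * (2 * u) ^+ n) (fun=> 1)).
  - near=> n; have /andP[un0 un1] := un n; rewrite -natE; apply/andP; split.
      have := @bernoulli_ge (n * 2 ^ n) (- u ^+ n); rewrite mulrN; apply; lra.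
    by rewrite exprn_ile1//; lra.
  - rewrite -[X in _ --> X]subr0; apply: cvgB; first exact: cvg_cst.
    by apply: cvg_natmul_geometric; lra.
  - exact: cvg_cst.
apply: (@squeeze_cvgr _ _ _ _ (fun=> 0) (fun n => n.+1%:R^-1)).
- near=> n; have /andP[un0 un1] := un n.
  set a := u ^+ n in un0 un1 *; set N := (n * 2 ^ n)%N.
  have a1 : 0 <= 1 - a by lra.
  rewrite exprn_ge0//=.
  have Na : n%:R <= N%:R * a.
    by rewrite natE ler_peMr// exprn_ege1//; lra.
  rewrite -(ler_pM2r (_ : 0 < n.+1%:R)) ?ltr0n// mulVf ?pnatr_eq0//.
  apply: (@le_trans _ _ ((1 - a) ^+ N * (1 + a) ^+ N)).
    rewrite ler_wpM2l ?exprn_ge0//; apply: le_trans (bernoulli_ge N _).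
      by rewrite -natr1 addrC lerD2l.
    by lra.
  rewrite -exprMn exprn_ile1//.
    by rewrite mulr_ge0//; lra.
  have : 0 <= a * a by rewrite mulr_ge0.
  by lra.
- exact: cvg_cst.
- exact: cvg_harmonic.
Unshelve. all: by end_near. Qed.

Lemma cvg_sin_sign (y : R) :
  ((sin (n.+1%:R^-1 * y) < 0)%R)%:R @[n --> \oo] --> (((y < 0)%R)%:R : R).
Proof.
apply: cvg_near_cst.
have pos (z : R) : 0 < z -> \forall n \near \oo, 0 < sin (n.+1%:R^-1 * z).
  move=> z0; near=> n; apply: sin2_gt0.
  rewrite mulr_gt0//= mulrC ltr_pdivrMr// -natr1.
  have : z <= n%:R by near: n; exact: nbhs_infty_ger.
  by have := ltr0n R n; lra.
have [y0|y0|->] := ltgtP y 0.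
- have yN : 0 < - y by rewrite oppr_gt0.
  near=> n; suff -> : sin (n.+1%:R^-1 * y) < 0 by [].
  by rewrite -oppr_gt0 -sinN -mulrN; near: n; exact: pos.
- near=> n; apply/eqP; rewrite pnatr_eq0 eqb0 -leNgt ltW//.
  by near: n; exact: pos.
- by near=> n; rewrite mulr0 sin0 ltxx.
Unshelve. all: by end_near. Qed.

End threshold_polynomials.

Section cramer_wold.
Context {R : realType} {d : nat}.
Implicit Types (P Q : probability 'cV[R]_d R) (f g : 'cV[R]_d -> R).

Definition bounded_borel f :=
  measurable_fun setT (f : _ -> measurableTypeR R) /\ exists M, forall x, `|f x| <= M.

Lemma bounded_borelM f g :
  bounded_borel f -> bounded_borel g -> bounded_borel (fun x => f x * g x).
Proof.
move=> [mf [M fM]] [mg [N gN]]; split; first exact: measurable_funM.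
by exists (M * N) => x; rewrite normrM ler_pM.
Qed.

Lemma bounded_borelD f g :
  bounded_borel f -> bounded_borel g -> bounded_borel (fun x => f x + g x).
Proof.
move=> [mf [M fM]] [mg [N gN]]; split; first exact: measurable_funD.
by exists (M + N) => x; rewrite (le_trans (ler_normD _ _))// lerD.
Qed.

Lemma bounded_borel_cst (c : R) : bounded_borel (fun=> c).
Proof. by split => //; exists `|c|. Qed.

Lemma integrable_bounded_borel P f :
  bounded_borel f -> P.-integrable setT (EFin \o f).
Proof.
move=> [mf [M fM]]; apply: measurable_bounded_integrable => //.
  by rewrite (le_lt_trans (probability_le1 P measurableT))// ltry.
exists M; split; first exact: num_real.
by move=> N MN x _ /=; rewrite (le_trans (fM x))// ltW.
Qed.

Definition wave (t : 'cV[R]_d) (c : R) x := cos (dotp t x + c).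

Lemma bounded_borel_wave t c : bounded_borel (wave t c).
Proof.
split; last by exists 1 => x; rewrite ler_norml cos_geN1 cos_le1.
rewrite /wave; apply: (@measurableT_comp _ _ _ _ _ _ cos).
  by apply: continuous_measurable_fun; exact: continuous_cos.
by apply: measurable_funD => //; exact: measurable_dotp.
Qed.

Lemma waveM s a t c x :
  wave s a x * wave t c x = 2^-1 * wave (s + t) (a + c) x + 2^-1 * wave (s - t) (a - c) x.
Proof.
rewrite /wave !dotpDl dotpNl.
set A := dotp s x + a; set B := dotp t x + c.
rewrite (_ : _ + (a + c) = A + B); last by rewrite /A /B; ring.
rewrite (_ : _ + (a - c) = A - B); last by rewrite /A /B; ring.
by rewrite cosD cosB; field.
Qed.

(** Testing against all waves, and not only against the constant 1, is what makes
    this class of functions stable under multiplication by a wave; linear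
    combinations and bounded limits then enlarge it up to the indicators of finite
    intersections of half-spaces. *)
Definition same_waves P Q f := bounded_borel f /\ forall t c,
  (\int[P]_x (f x * wave t c x)%:E = \int[Q]_x (f x * wave t c x)%:E)%E.

Lemma same_wavesD P Q f g :
  same_waves P Q f -> same_waves P Q g -> same_waves P Q (fun x => f x + g x).
Proof.
move=> [bf fPQ] [bg gPQ]; split => [|t c]; first exact: bounded_borelD.
under eq_integral do rewrite mulrDl EFinD.
under [RHS]eq_integral do rewrite mulrDl EFinD.
rewrite !integralD//= ?fPQ ?gPQ//;
  by apply: integrable_bounded_borel; apply: bounded_borelM => //; exact: bounded_borel_wave.
Qed.

Lemma same_wavesZ P Q a f : same_waves P Q f -> same_waves P Q (fun x => a * f x).
Proof.
move=> [bf fPQ]; split => [|t c].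
  by apply: bounded_borelM => //; exact: bounded_borel_cst.
under eq_integral do rewrite -mulrA EFinM.
under [RHS]eq_integral do rewrite -mulrA EFinM.
rewrite !integralZl//= ?fPQ//;
  by apply: integrable_bounded_borel; apply: bounded_borelM => //; exact: bounded_borel_wave.
Qed.

Lemma same_waves_wave P Q s a f :
  same_waves P Q f -> same_waves P Q (fun x => f x * wave s a x).
Proof.
move=> fPQ; split => [|t c].
  by apply: bounded_borelM; [case: fPQ|exact: bounded_borel_wave].
have [bf eqf] := fPQ.
under eq_integral do rewrite -mulrA waveM mulrDr EFinD !(mulrCA (f _) 2^-1) !EFinM.
under [RHS]eq_integral do rewrite -mulrA waveM mulrDr EFinD !(mulrCA (f _) 2^-1) !EFinM.
have ifw (S : probability 'cV[R]_d R) t' c' : S.-integrable setT (fun x => (f x * wave t' c' x)%:E).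
  by apply: integrable_bounded_borel; apply: bounded_borelM => //; exact: bounded_borel_wave.
rewrite !integralD//=; try by apply: integrableZl => //; exact: ifw.
by rewrite !integralZl//= ?eqf//; exact: ifw.
Qed.

Lemma same_waves_lim P Q (f_ : nat -> 'cV[R]_d -> R) f M :
  (forall n, same_waves P Q (f_ n)) -> (forall n x, `|f_ n x| <= M) ->
  (forall x, f_ n x @[n --> \oo] --> f x) -> same_waves P Q f.
Proof.
move=> fPQ fM f_f.
have mf : measurable_fun setT (f : _ -> measurableTypeR R).
  apply: (@measurable_fun_cvg _ _ _ _ f_) => [n|x _]; last exact: f_f.
  by have [[]] := fPQ n.
have bf : bounded_borel f.
  split => //; exists M => x.
  apply: (@cvgr_to_le _ \oo _ _ (fun n => `|f_ n x|)).
    by apply: cvg_norm; exact: f_f.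
  by near=> n; exact: fM.
split => // t c.
have lim (S : probability 'cV[R]_d R) : (\int[S]_x (f_ n x * wave t c x)%:E)%E @[n --> \oo] -->
    (\int[S]_x (f x * wave t c x)%:E)%E.
  have [] := @dominated_convergence _ _ _ S setT measurableT
    (fun n x => (f_ n x * wave t c x)%:E) (fun x => (f x * wave t c x)%:E)
    (fun=> M%:E) => //.
  - move=> n; apply/measurable_EFinP.
    by have [] := bounded_borelM (proj1 (fPQ n)) (bounded_borel_wave t c).
  - apply/measurable_EFinP.
    by have [] := bounded_borelM bf (bounded_borel_wave t c).
  - apply: aeW => x _; apply: cvg_EFin; first by near=> n.
    by apply: cvgM; [exact: f_f|exact: cvg_cst].
  - exact: (integrable_bounded_borel S (bounded_borel_cst M)).
  - apply: aeW => x n _; rewrite lee_fin normrM -[leRHS]mulr1 ler_pM//.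
    by rewrite ler_norml cos_geN1 cos_le1.
apply: (cvg_unique _ (lim P)) => //.
rewrite (_ : (fun n => _) = (fun n => \int[Q]_x (f_ n x * wave t c x)%:E)%E); last first.
  by apply/funext => n; rewrite (proj2 (fPQ n)).
exact: lim.
Unshelve. all: by end_near. Qed.

(** Stability under multiplication by u extends to polynomials in u, and then to the
    limit of the threshold polynomials. *)
Lemma same_waves_threshold P Q (u : 'cV[R]_d -> R) :
  measurable_fun setT (u : _ -> measurableTypeR R) ->
  (forall x, 0 <= u x <= 1) ->
  (forall f, same_waves P Q f -> same_waves P Q (fun x => f x * u x)) ->
  forall f, same_waves P Q f -> same_waves P Q (fun x => f x * ((u x < 2^-1)%R)%:R).
Proof.
move=> mu u01 fu f fPQ.
have fX n g : same_waves P Q g -> same_waves P Q (fun x => g x * u x ^+ n).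
  elim: n g => [|n ih] g gPQ.
    by under eq_fun do rewrite expr0 mulr1.
  by under eq_fun do rewrite exprSr mulrA; exact/fu/ih.
have fBX n N g : same_waves P Q g ->
    same_waves P Q (fun x => g x * (1 - u x ^+ n) ^+ N).
  elim: N g => [|N ih] g gPQ.
    by under eq_fun do rewrite expr0 mulr1.
  under eq_fun do rewrite exprS mulrA mulrBr mulr1 -mulN1r mulrA.
  apply/ih/same_wavesD => //; apply: (fX _ (fun x => -1 * g x)).
  exact: same_wavesZ.
have [[_ [M fM]] _] := fPQ.
apply: (@same_waves_lim _ _
  (fun n x => f x * (1 - u x ^+ n) ^+ (n * 2 ^ n)%N) _ M) => [n|n x|x].
- exact: fBX.
- rewrite normrM -[leRHS]mulr1 ler_pM// ger0_norm.
    rewrite exprn_ile1// ?subr_ge0 ?lerBlDr ?lerDl.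
      by rewrite exprn_ile1//; have /andP[] := u01 x.
    by rewrite exprn_ge0//; have /andP[] := u01 x.
  by rewrite exprn_ge0// subr_ge0 exprn_ile1//; have /andP[] := u01 x.
- by apply: cvgM; [exact: cvg_cst|exact: cvg_threshold_polynomial].
Qed.

(** The function u_n = (1 + sin ((<t, x> - a) / (n + 1))) / 2 is below 1/2 exactly
    when the sine is negative. The latter is a periodic condition on <t, x> - a,
    but the period grows with n, so that in the limit it becomes <t, x> < a. *)
Lemma same_waves_halfspace P Q t a f : same_waves P Q f ->
  same_waves P Q (fun x => f x * ((dotp t x < a)%R)%:R).
Proof.
move=> fPQ.
pose s n (x : 'cV[R]_d) : R := sin (n.+1%:R^-1 * (dotp t x - a)).
pose w n := wave (n.+1%:R^-1 *: t) (- (n.+1%:R^-1 * a) - pi / 2).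
have wE n x : w n x = s n x.
  rewrite /w /wave /s dotpZl addrA -mulrN -mulrDr.
  by rewrite cosB cos_pihalf sin_pihalf mulr0 add0r mulr1.
pose u n x := 2^-1 * (1 + w n x).
have [[_ [M fM]] _] := fPQ.
apply: (@same_waves_lim _ _ (fun n x => f x * ((u n x < 2^-1)%R)%:R) _ M).
- move=> n; apply: same_waves_threshold => //.
  + apply: measurable_funM => //; apply: measurable_funD => //.
    by have [] := bounded_borel_wave (n.+1%:R^-1 *: t) (- (n.+1%:R^-1 * a) - pi / 2).
  + move=> x; rewrite /u wE.
    by have := sin_geN1 (n.+1%:R^-1 * (dotp t x - a));
       have := sin_le1 (n.+1%:R^-1 * (dotp t x - a)); rewrite -/(s n x); lra.
  + move=> g gPQ; rewrite /u.
    under eq_fun do rewrite mulrCA mulrDr mulr1.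
    by apply/same_wavesZ/same_wavesD => //; exact: same_waves_wave.
- by move=> n x; rewrite normrM -[leRHS]mulr1 ler_pM// normr_nat lern1; case: ltP.
- move=> x; apply: cvgM; first exact: cvg_cst.
  have uE n : (u n x < 2^-1) = (s n x < 0).
    by rewrite /u wE -[ltRHS]mulr1 ltr_pM2l// gtrDl.
  under eq_fun do rewrite uE.
  by rewrite -subr_lt0; exact: cvg_sin_sign.
Qed.

Theorem cramer_wold P Q :
  (forall t B, measurable B -> pushforward P (dotp t : _ -> measurableTypeR R) B =
     pushforward Q (dotp t : _ -> measurableTypeR R) B) ->
  forall A, measurable A -> P A = Q A.
Proof.
move=> PQ.
(* The only use of the projections: the law of <t, x> gives the integrals of waves. *)
have one : same_waves P Q (fun=> 1).
  split=> [|t c]; first exact: bounded_borel_cst.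
  under eq_integral do rewrite mul1r.
  under [RHS]eq_integral do rewrite mul1r.
  have mcos : measurable_fun setT (fun y : measurableTypeR R => (cos (y + c))%:E).
    apply/measurable_EFinP; apply: (@measurableT_comp _ _ _ _ _ _ cos).
      by apply: continuous_measurable_fun; exact: continuous_cos.
    exact: measurable_funD.
  have push (S : probability 'cV[R]_d R) : (\int[S]_x (wave t c x)%:E =
      \int[pushforward S (dotp t : _ -> measurableTypeR R)]_y (cos (y + c))%:E)%E.
    rewrite integral_pushforward//; first exact: measurable_dotp.
    exact: (integrable_bounded_borel S (bounded_borel_wave t c)).
  rewrite !push; apply: eq_measure_integral.
  - exact: measurable_dotp.
  - exact: measurable_dotp.
  - by move=> mP mQ B mB BT; exact: PQ.
have half s : same_waves P Q (\1_(halfspaces s)).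
  elim: s => [|[t a] s ih].
    by rewrite (_ : halfspaces _ = setT) ?indicT//; apply/seteqP; split.
  rewrite halfspaces_cons setIC.
  have -> : \1_(halfspaces s `&` [set x | dotp t x < a]) =
     (fun x => \1_(halfspaces s) x * ((dotp t x < a)%R)%:R) :> ('cV[R]_d -> R).
    apply/funext => x; rewrite indicI; congr (_ * _).
    rewrite indicE; case: (boolP (dotp t x < a)) => tx; first by rewrite mem_set.
    by rewrite memNset//; exact/negP.
  exact: same_waves_halfspace.
apply: (measure_unique (range (@halfspaces R d)) (fun=> setT)).
- exact: borel_halfspaces.
- move=> _ _ [s _ <-] [s' _ <-]; exists (s ++ s') => //.
  apply/seteqP; split=> x /= h.
    by split=> p ps; apply: h; rewrite mem_cat ps ?orbT.
  by move=> p; rewrite mem_cat => /orP[]; [apply: h.1|apply: h.2].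
- by move=> _; exists [::] => //; apply/seteqP; split.
- by rewrite bigcup_const//; exists 0%N.
- move=> _ [s _ <-].
  (* The wave with zero frequency and zero phase is the constant 1. *)
  have [_ /(_ 0 0)] := half s.
  under eq_integral do rewrite /wave dotp0l add0r cos0 mulr1.
  under [RHS]eq_integral do rewrite /wave dotp0l add0r cos0 mulr1.
  by rewrite !integral_indic ?setIT//; exact: measurable_halfspaces.
- by move=> _; rewrite (le_lt_trans (probability_le1 P measurableT))// ltry.
Qed.

End cramer_wold.

(** * Integrals with finite values *)

Section has_integral.
Context {R : realType} d (T : measurableType d).
Implicit Types (mu : {measure set T -> \bar R}) (f g : T -> R) (r s : R).

(** Integrability and value go together, so that linear combinations carry no side
    conditions. *)
Definition has_int mu f r :=
  mu.-integrable setT (EFin \o f) /\ (\int[mu]_x (f x)%:E = r%:E)%E.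

Lemma has_int_unique mu f r s : has_int mu f r -> has_int mu f s -> r = s.
Proof. by move=> [_ fr] [_]; rewrite fr => -[]. Qed.

Lemma has_intZ mu c f r : has_int mu f r -> has_int mu (fun x => c * f x) (c * r).
Proof.
move=> [fi fr]; split.
  by under [X in mu.-integrable _ X]eq_fun do rewrite /= EFinM; exact: integrableZl.
by under eq_integral do rewrite EFinM; rewrite integralZl//= fr.
Qed.

Lemma has_intD mu f g r s :
  has_int mu f r -> has_int mu g s -> has_int mu (fun x => f x + g x) (r + s).
Proof.
move=> [fi fr] [gi gs]; split.
  by under [X in mu.-integrable _ X]eq_fun do rewrite /= EFinD; exact: integrableD.
by under eq_integral do rewrite EFinD; rewrite integralD//= fr gs.
Qed.

Lemma has_int_sum mu (I : Type) (s : seq I) (f : I -> T -> R) (r : I -> R) :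
  (forall i, has_int mu (f i) (r i)) ->
  has_int mu (fun x => \sum_(i <- s) f i x) (\sum_(i <- s) r i).
Proof.
move=> fr; elim: s => [|i s ih].
  under eq_fun do rewrite big_nil; rewrite big_nil; split.
    exact: integrable0.
  exact: integral0.
by under eq_fun do rewrite big_cons; rewrite big_cons; exact: has_intD.
Qed.

Lemma has_int_cst (P : probability T R) r : has_int P (fun=> r) r.
Proof.
split; first exact: finite_measure_integrable_cst.
have -> : (\int[P]_x r%:E = r%:E * P setT)%E by rewrite integral_cst.
by have -> : P setT = 1%E := probability_setT P; rewrite mule1.
Qed.

End has_integral.

Lemma has_int_law {R : realType} d d' (T : measurableType d) (Y : measurableType d')
    (mu : {measure set T -> \bar R}) (nu : {measure set Y -> \bar R})
    (X : T -> Y) (f : Y -> R) r :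
  measurable_fun setT X ->
  (forall B, measurable B -> mu (X @^-1` B) = nu B) ->
  has_int nu f r -> has_int mu (f \o X) r.
Proof.
move=> mX munu [fi fr].
have mf : measurable_fun setT (EFin \o f) := measurable_int _ fi.
have fXi : mu.-integrable setT ((EFin \o f) \o X).
  apply/integrableP; split; first exact: measurableT_comp.
  have /integrableP[_] := fi; apply: le_lt_trans.
  have mabs : measurable_fun setT (abse \o (EFin \o f)) by exact: measurableT_comp.
  rewrite -[X in (X <= _)%E](@ge0_integral_pushforward _ _ _ _ _ _ mX mu setT (abse \o (EFin \o f)))//.
  rewrite le_eqVlt; apply/orP; left; apply/eqP; apply: eq_measure_integral.
    by move=> B mB _; exact: munu.
  by move=> y _; exact: abse_ge0.
split => //.
rewrite -fr -[LHS](@integral_pushforward _ _ _ _ _ _ mX mu setT (EFin \o f))//.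
apply: eq_measure_integral.
by move=> B mB _; exact: munu.
Qed.

Section iterated_integral.
Context {R : realType} d (T : measurableType d) (P : probability T R).
Implicit Types (g : T -> T -> R).

(** The inner integral h is kept as a function, so that linear combinations are
    handled in one variable at a time. *)
Definition has_int2 g r := exists h : T -> R,
  (forall z, has_int P (g z) (h z)) /\ has_int P h r.

Lemma has_int2_integral g r : has_int2 g r ->
  (\int[P]_z \int[P]_z' (g z z')%:E = r%:E)%E.
Proof.
move=> [h [gh hr]]; under eq_integral do rewrite (gh _).2.
exact: hr.2.
Qed.

Lemma has_int2Z g r c : has_int2 g r -> has_int2 (fun z z' => c * g z z') (c * r).
Proof.
move=> [h [gh hr]]; exists (fun z => c * h z).
by split=> [z|]; exact: has_intZ.
Qed.

Lemma has_int2D g g' r r' : has_int2 g r -> has_int2 g' r' ->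
  has_int2 (fun z z' => g z z' + g' z z') (r + r').
Proof.
move=> [h [gh hr]] [h' [gh' hr']]; exists (fun z => h z + h' z).
by split=> [z|]; exact: has_intD.
Qed.

Lemma has_int2_sum (I : Type) (s : seq I) (g : I -> T -> T -> R) (r : I -> R) :
  (forall i, has_int2 (g i) (r i)) ->
  has_int2 (fun z z' => \sum_(i <- s) g i z z') (\sum_(i <- s) r i).
Proof.
move=> /choice[h gh]; exists (fun z => \sum_(i <- s) h i z).
by split=> [z|]; apply: has_int_sum => i; case: (gh i).
Qed.

End iterated_integral.

(** * Moments of the Gaussian law on the line *)

Section normal_moments.
Context {R : realType}.
Local Notation lambda := (@lebesgue_measure R).
Implicit Types (a s : R).

(** The density agrees almost everywhere with the Radon-Nikodym derivative, for which
    the change of measure holds. *)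
Lemma has_int_normal_prob a s (f : R -> R) r : s != 0 ->
  measurable_fun setT (f : measurableTypeR R -> measurableTypeR R) ->
  has_int lambda (fun x => f x * normal_pdf a s x) r ->
  has_int (normal_prob a s) f r.
Proof.
move=> s0 mf [fi fr].
have dom := normal_prob_dominates a s.
have mpdf : measurable_fun setT (fun x => (normal_pdf a s x)%:E).
  by apply/measurable_EFinP; exact: measurable_normal_pdf.
pose h := Radon_Nikodym_SigmaFinite.f (normal_prob a s) lambda.
have hpdf : ae_eq lambda setT h (fun x => (normal_pdf a s x)%:E).
  apply: integral_ae_eq => //.
    exact: Radon_Nikodym_SigmaFinite.f_integrable.
  by move=> E _ mE; rewrite -Radon_Nikodym_SigmaFinite.f_integral.
have mh : measurable_fun setT h.
  by apply: (measurable_int lambda); exact: Radon_Nikodym_SigmaFinite.f_integrable.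
have mEf : measurable_fun setT (EFin \o f) by exact/measurable_EFinP.
have fin : (normal_prob a s).-integrable setT (EFin \o f).
  apply/integrableP; split => //.
  rewrite -(Radon_Nikodym_SigmaFinite.change_of_variables dom)//=; last first.
    by apply/measurable_EFinP; exact: measurableT_comp.
  have /integrableP[_] := fi; apply: le_lt_trans.
  rewrite le_eqVlt; apply/orP; left; apply/eqP; apply: ae_eq_integral => //.
  - apply: emeasurable_funM => //.
    by apply/measurable_EFinP; exact: measurableT_comp.
  - by apply: measurableT_comp => //; exact: (measurable_int _ fi).
  - apply: filterS hpdf => x hx _ /=; rewrite -/h hx//.
    by rewrite normrM EFinM (ger0_norm (normal_pdf_ge0 _ _ _)).
split => //.
rewrite -fr -(Radon_Nikodym_change_of_variables dom)//=.
apply: ae_eq_integral => //.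
- by apply: emeasurable_funM => //; apply: (measurable_int lambda); exact: Radon_Nikodym_integrable.
- exact: (measurable_int _ fi).
- have := ae_eq_Radon_Nikodym_SigmaFinite dom measurableT.
  apply: filterS2 hpdf => x hx hx' _ /=.
  by rewrite -hx'// -/h hx.
Qed.

(** The fundamental theorem of calculus on [- n, n], followed by dominated convergence. *)
Lemma integral_total_derivative (F f : R -> R) :
  continuous f -> (forall x, is_derive x (1:R) F (f x)) ->
  lambda.-integrable setT (EFin \o f) ->
  F n%:R @[n --> \oo] --> (0 : R) -> F (- n%:R) @[n --> \oo] --> (0 : R) ->
  has_int lambda f 0.
Proof.
move=> cf dF fi Fy FNy; split => //.
pose D (n : nat) : set R := [set` `[- n%:R, n%:R]].
have mf : measurable_fun setT (EFin \o f) := measurable_int _ fi.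
have lim1 : (\int[lambda]_(x in D n) (f x)%:E)%E @[n --> \oo] -->
    (\int[lambda]_x (f x)%:E)%E.
  have [] := @dominated_convergence _ _ _ lambda setT measurableT
    (fun n => (fun x => (f x)%:E) \_ (D n)) (fun x => (f x)%:E)
    (abse \o (EFin \o f)) => //.
  - move=> n; apply/(measurable_restrictT _ _).1; first exact: measurable_itv.
    exact: measurable_funTS.
  - apply: aeW => x _; apply: cvg_near_cst; near=> n.
    rewrite patchE mem_set// /D /= in_itv/= -ler_norml.
    by near: n; exact: nbhs_infty_ger.
  - exact: integrable_abse.
  - apply: aeW => x n _; rewrite patchE; case: ifP => // _.
    by rewrite abse0 abse_ge0.
  - by move=> _ _; under eq_fun do rewrite -integral_mkcond.
have lim2 : (F n%:R - F (- n%:R))%:E @[n --> \oo] --> 0%:E.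
  apply: cvg_EFin; first by near=> n.
  by rewrite -(subrr (0 : R)); exact: cvgB.
apply: (cvg_unique _ lim1) => //.
apply: cvg_trans lim2; apply: near_eq_cvg; near=> n.
have n0 : 0 < n%:R :> R by rewrite ltr0n; near: n; exists 1%N.
have dF1 x : derivable F x 1 by have [] := dF x.
have cF : continuous F.
  by move=> x; apply: differentiable_continuous; exact/derivable1_diffP.
rewrite /D (@continuous_FTC2 _ f F) -?EFinB//.
- lra.
- exact: continuous_subspaceT.
- split => [x _||]; first exact: dF1.
    by apply: cvg_at_right_filter; exact: cF.
  by apply: cvg_at_left_filter; exact: cF.
- by move=> x _; rewrite derive1E; have [] := dF x.
Unshelve. all: by end_near. Qed.

Lemma normal_pdf_is_derive a s x : s != 0 ->
  is_derive x (1 : R) (normal_pdf a s) (- (x - a) / s ^+ 2 * normal_pdf a s x).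
Proof.
move=> s0; rewrite normal_pdfE//.
have dg : is_derive x (1 : R) (fun y : R => - (y - a) ^+ 2 / (s ^+ 2 *+ 2))
    (- (x - a) / s ^+ 2).
  have -> : (fun y : R => - (y - a) ^+ 2 / (s ^+ 2 *+ 2)) =
      - (s ^+ 2 *+ 2)^-1 \*: ((id \- cst a) ^+ 2).
    by apply/funext => y; rewrite /= exprfctE /GRing.scale /=; ring.
  by apply: is_derive_eq; rewrite /GRing.scale /=; field.
have -> : (fun x : R => normal_peak s * normal_fun a s x) =
    normal_peak s \*: (expR \o (fun y : R => - (y - a) ^+ 2 / (s ^+ 2 *+ 2))) by [].
have := is_deriveZ (normal_peak s) (is_derive1_comp (is_derive_expR _) dg).
move/is_derive_eq; apply; rewrite /normal_fun /GRing.scale /=; ring.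
Qed.

(** A power is absorbed by a Gaussian factor at the price of doubling the variance.
    With z = (x - a)^2 / (4 s^2), the density is proportional to exp (- 2 z), the
    wider one to exp (- z), and z^2 <= 2 exp z. *)
Lemma quartic_normal_pdf a s x : s != 0 ->
  (x - a) ^+ 4 * normal_pdf a s x <=
  32 * s ^+ 4 * (normal_peak s / normal_peak (Num.sqrt 2 * s)) *
  normal_pdf a (Num.sqrt 2 * s) x.
Proof.
move=> s0.
have s20 : Num.sqrt 2 * s != 0 by rewrite mulf_neq0// gt_eqF// sqrtr_gt0.
rewrite !normal_pdfE//.
have p0 : normal_peak (Num.sqrt 2 * s) != 0 by rewrite gt_eqF ?normal_peak_gt0.
rewrite [leRHS](_ : _ = normal_peak s * (32 * s ^+ 4 * normal_fun a (Num.sqrt 2 * s) x)); last first.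
  by field.
rewrite mulrCA ler_wpM2l ?normal_peak_ge0//.
rewrite /normal_fun exprMn sqr_sqrtr//.
set y := x - a.
have ss : 0 < s ^+ 2 by rewrite exprn_even_gt0.
pose z := y ^+ 2 / (4 * s ^+ 2).
have z0 : 0 <= z by rewrite divr_ge0 ?sqr_ge0// mulr_ge0 ?sqr_ge0.
have -> : - y ^+ 2 / (s ^+ 2 *+ 2) = - (z + z) by rewrite /z; field.
have -> : - y ^+ 2 / ((2 * s ^+ 2) *+ 2) = - z by rewrite /z; field.
have -> : y ^+ 4 = 16 * s ^+ 4 * z ^+ 2 by rewrite /z; field.
rewrite opprD expRD mulrA ler_wpM2r ?expR_ge0//.
have := @expR_ge1Dxn R z 1 z0; rewrite /= => ez.
have ez2 : z ^+ 2 <= 2 * expR z.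
  have : (2`!)%:R = 2 :> R by [].
  by move=> f2; rewrite f2 in ez; lra.
rewrite expRN ler_pdivrMr ?expR_gt0//.
have s4 : 0 <= s ^+ 4 by rewrite exprn_even_ge0.
by nra.
Qed.

(** Since |x - a|^k <= (x - a)^4 + 1, [quartic_normal_pdf] provides an integrable
    dominating function. *)
Lemma integrable_normal_moment a s k : s != 0 -> (k <= 4)%N ->
  lambda.-integrable setT (EFin \o (fun x => (x - a) ^+ k * normal_pdf a s x)).
Proof.
move=> s0 k4.
set C := 32 * s ^+ 4 * (normal_peak s / normal_peak (Num.sqrt 2 * s)).
apply: (@le_integrable _ (measurableTypeR R) R lambda setT measurableT
  (fun x => ((x - a) ^+ k * normal_pdf a s x)%:E)
  (fun x => C%:E * (normal_pdf a (Num.sqrt 2 * s) x)%:E + (normal_pdf a s x)%:E)%E).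
- apply/measurable_EFinP; apply: measurable_funM; last exact: measurable_normal_pdf.
  by apply: measurable_funX; exact: measurable_funB.
- move=> x _; rewrite -EFinM -EFinD /= lee_fin.
  apply: le_trans (ler_norm _); rewrite normrM (ger0_norm (normal_pdf_ge0 _ _ _)).
  apply: (@le_trans _ _ ((x - a) ^+ 4 * normal_pdf a s x + normal_pdf a s x)).
    have -> : (x - a) ^+ 4 * normal_pdf a s x + normal_pdf a s x =
      ((x - a) ^+ 4 + 1) * normal_pdf a s x by rewrite mulrDl mul1r.
    rewrite ler_wpM2r ?normal_pdf_ge0//.
    rewrite normrX -(@ger0_norm _ ((x - a) ^+ 4)) ?exprn_even_ge0// normrX.
    have [y1|y1] := leP `|x - a| 1.
      by apply: (@le_trans _ _ 1); [exact: exprn_ile1|rewrite lerDr exprn_ge0].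
    by rewrite (le_trans (ler_weXn2l _ k4)) ?ltW// ltrDl.
  by rewrite lerD2r; exact: quartic_normal_pdf.
- apply: integrableD => //; last exact: integrable_normal_pdf.
  by apply: integrableZl => //; exact: integrable_normal_pdf.
Qed.

(** By [quartic_normal_pdf], |x - a|^k times the density is at most C / |x - a| as soon
    as |x - a| >= 1. *)
Lemma cvg_normal_tail a s k : s != 0 -> (k <= 3)%N ->
  ((n%:R - a) ^+ k * normal_pdf a s n%:R @[n --> \oo] --> (0 : R)) /\
  ((- n%:R - a) ^+ k * normal_pdf a s (- n%:R) @[n --> \oo] --> (0 : R)).
Proof.
move=> s0 k3.
set C := 32 * s ^+ 4 * (normal_peak s / normal_peak (Num.sqrt 2 * s)) * normal_peak (Num.sqrt 2 * s).
have s20 : Num.sqrt 2 * s != 0 by rewrite mulf_neq0// gt_eqF// sqrtr_gt0.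
have bound x : 1 <= `|x - a| -> `|(x - a) ^+ k * normal_pdf a s x| <= C / `|x - a|.
  move=> x1; have x0 : 0 < `|x - a| by lra.
  rewrite ler_pdivlMr// normrM (ger0_norm (normal_pdf_ge0 _ _ _)) mulrAC normrX -exprSr.
  have := quartic_normal_pdf a x s0 => /le_trans h.
  have {}h := h C; apply: le_trans (h _); last first.
    rewrite ler_wpM2l ?normal_pdf_ub// mulr_ge0 ?divr_ge0 ?normal_peak_ge0//.
    by rewrite mulr_ge0// exprn_even_ge0.
  rewrite ler_wpM2r ?normal_pdf_ge0//.
  rewrite -(@ger0_norm _ ((x - a) ^+ 4)) ?exprn_even_ge0// normrX.
  exact: ler_weXn2l.
have go (u : nat -> R) : `|u n - a| @[n --> \oo] --> +oo ->
    (u n - a) ^+ k * normal_pdf a s (u n) @[n --> \oo] --> (0 : R).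
  move=> uy; apply/norm_cvg0P.
  apply: (@squeeze_cvgr _ _ _ _ (fun=> 0) (fun n => C / `|u n - a|)).
  - near=> n; rewrite normr_ge0/= bound//.
    by near: n; exact: (cvgryPge _).1.
  - exact: cvg_cst.
  - rewrite -[X in _ --> X](mulr0 C); apply: cvgMr.
    by apply/gtr0_cvgV0 => //; near=> n; near: n; exact: (cvgryPgt _).1.
have ny (c : R) : `|n%:R + c| @[n --> \oo] --> +oo.
  apply/cvgryPge => A; near=> n; apply: le_trans (ler_norm _).
  rewrite -lerBlDr; near: n; exact: nbhs_infty_ger.
split; apply: go; first exact: ny.
by under eq_fun do rewrite -opprD normrN; exact: ny.
Unshelve. all: by end_near. Qed.

(** Integration by parts on the line: the density p satisfies
    ((x - a)^k p)' = k (x - a)^(k-1) p - (x - a)^(k+1) p / s^2, and the integral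
    of this derivative vanishes. For k = 0 the factor k kills the first term, so
    the truncated predecessor does no harm. *)
Lemma normal_moment_rec a s k m : s != 0 -> (k <= 3)%N ->
  has_int lambda (fun x => (x - a) ^+ k.-1 * normal_pdf a s x) m ->
  has_int lambda (fun x => (x - a) ^+ k.+1 * normal_pdf a s x) (s ^+ 2 * (k%:R * m)).
Proof.
move=> s0 k3 mk.
pose f x := k%:R * ((x - a) ^+ k.-1 * normal_pdf a s x) -
  (s ^+ 2)^-1 * ((x - a) ^+ k.+1 * normal_pdf a s x).
have [tp tn] := cvg_normal_tail a s0 k3.
have f0 : has_int lambda f 0.
  apply: (integral_total_derivative (F := fun x => (x - a) ^+ k * normal_pdf a s x)) => //.
  - have cp := @continuous_normal_pdf R a s s0.
    have cX j : continuous (fun x : R => (x - a) ^+ j * normal_pdf a s x).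
      move=> x; apply: cvgM; last exact: cp.
      apply: (@cvg_comp _ _ _ (fun x => x - a) (fun y => y ^+ j)); last exact: exprn_continuous.
      by apply: cvgB; [exact: cvg_id|exact: cvg_cst].
    by move=> x; apply: cvgB; apply: cvgM; [exact: cvg_cst|exact: cX|exact: cvg_cst|exact: cX].
  - move=> x; have dp := normal_pdf_is_derive a x s0.
    have -> : (fun x : R => (x - a) ^+ k * normal_pdf a s x) =
       (id \- cst a) ^+ k * normal_pdf a s by apply/funext => y; rewrite fctE exprfctE.
    apply: is_derive_eq; rewrite exprfctE /f /GRing.scale /= (exprS (x - a) k).
    by move: ((x - a) ^+ k) ((x - a) ^+ k.-1) => A B; field.
  - rewrite (_ : _ \o _ = (fun x => (k%:R * ((x - a) ^+ k.-1 * normal_pdf a s x))%:E -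
        (s ^+ 2)^-1%:E * ((x - a) ^+ k.+1 * normal_pdf a s x)%:E)%E); last first.
      by apply/funext => x; rewrite /= /f EFinB !EFinM.
    apply: integrableB => //; last first.
      by apply: integrableZl => //; exact: integrable_normal_moment.
    by have [] := has_intZ k%:R mk.
have := has_intD (has_intZ (s ^+ 2) (has_intZ k%:R mk)) (has_intZ (- s ^+ 2) f0).
rewrite mulr0 addr0; congr has_int; apply/funext => x; rewrite /f.
by field.
Qed.

(** The centred moments of order 0 to 4 of a Gaussian law of variance v. *)
Definition gaussian_moment (k : nat) (v : R) : R :=
  nth 0 [:: 1; 0; v; 0; 3 * v ^+ 2] k.

Lemma has_int_normal_moment a s k : s != 0 -> (k <= 4)%N ->
  has_int lambda (fun x => (x - a) ^+ k * normal_pdf a s x) (gaussian_moment k (s ^+ 2)).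
Proof.
move=> s0.
have M0 : has_int lambda (fun x => (x - a) ^+ 0 * normal_pdf a s x) 1.
  split; first exact: integrable_normal_moment.
  by under eq_integral do rewrite expr0 mul1r; exact: integral_normal_pdf.
have M1 := @normal_moment_rec a s 0 _ s0 isT M0.
have M2 := @normal_moment_rec a s 1 _ s0 isT M0.
have M3 := @normal_moment_rec a s 2 _ s0 isT M1.
have M4 := @normal_moment_rec a s 3 _ s0 isT M2.
case: k => [|[|[|[|[|//]]]]] _; rewrite /gaussian_moment/=.
- exact: M0.
- by move: M1; rewrite mul0r mulr0.
- by move: M2; rewrite mulr1 mulr1.
- by move: M3; rewrite mul0r !mulr0.
- by move: M4; rewrite mulr1 mulr1; congr has_int; ring.
Qed.

Lemma has_int_gaussian1 d (T : measurableType d) (mu : {measure set T -> \bar R})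
    (X : T -> measurableTypeR R) a v k :
  measurable_fun setT X -> 0 <= v -> (k <= 4)%N ->
  (forall B, measurable B -> mu (X @^-1` B) = gaussian1 a v B) ->
  has_int mu (fun x => (X x - a) ^+ k) (gaussian_moment k v).
Proof.
move=> mX v0 k4; rewrite /gaussian1; have mk : measurable_fun setT
    ((fun x => (x - a) ^+ k) : measurableTypeR R -> measurableTypeR R).
  by apply: measurable_funX; exact: measurable_funB.
have [->|vn0] := eqVneq v 0 => law.
  have h : has_int (\d_(a : measurableTypeR R) : {measure set measurableTypeR R -> \bar R})
      (fun x => (x - a) ^+ k) (gaussian_moment k 0).
    split.
      apply/integrableP; split; first exact/measurable_EFinP.
      rewrite integral_dirac//; last by apply/measurable_EFinP; exact: measurableT_comp.
      by rewrite diracT mul1e/= ltry.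
    rewrite integral_dirac//; last exact/measurable_EFinP.
    rewrite diracT mul1e subrr.
    by move: k k4 {mk} => [|[|[|[|[|//]]]]] _; rewrite /gaussian_moment/= expr0n//= expr0n/= mulr0.
  exact: (has_int_law mX law h).
have s0 : Num.sqrt v != 0 by rewrite gt_eqF// sqrtr_gt0 lt_def vn0.
have h : has_int (normal_prob a (Num.sqrt v)) (fun x => (x - a) ^+ k) (gaussian_moment k v).
  apply: has_int_normal_prob => //.
  by rewrite -{2}(sqr_sqrtr v0); exact: has_int_normal_moment.
exact: (has_int_law mX law h).
Qed.

(** The mean is the first moment and the variance the second centred one. *)
Lemma gaussian1_inj d (T : measurableType d) (P : probability T R)
    (X : T -> measurableTypeR R) (a v b w : R) :
  measurable_fun setT X -> 0 <= v -> 0 <= w ->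
  (forall B, measurable B -> P (X @^-1` B) = gaussian1 a v B) ->
  (forall B, measurable B -> P (X @^-1` B) = gaussian1 b w B) ->
  a = b /\ v = w.
Proof.
move=> mX v0 w0 lawa lawb.
have A k : (k <= 4)%N -> has_int P (fun z => (X z - a) ^+ k) (gaussian_moment k v).
  by move=> k4; exact: (has_int_gaussian1 mX v0 k4 lawa).
have B k : (k <= 4)%N -> has_int P (fun z => (X z - b) ^+ k) (gaussian_moment k w).
  by move=> k4; exact: (has_int_gaussian1 mX w0 k4 lawb).
have ab : a = b.
  have h := has_intD (A 1%N isT) (has_int_cst P (a - b)).
  have {}h : has_int P (fun z => (X z - b) ^+ 1) (0 + (a - b)).
    by move: h; congr has_int; apply/funext => z; ring.
  by have := has_int_unique h (B 1%N isT); rewrite /gaussian_moment/=; lra.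
split => //; rewrite -{}ab in B.
exact: (has_int_unique (A 2%N isT) (B 2%N isT)).
Qed.

Lemma lebesgue_measure_translate (c : R) (B : set (measurableTypeR R)) :
  measurable B -> lambda ((fun x => x + c) @^-1` B) = lambda B.
Proof.
move=> mB; pose phi : measurableTypeR R -> measurableTypeR R := fun x => x + c.
have mphi : measurable_fun setT phi by exact: measurable_funD.
have := @lebesgue_measure_unique R (measure_function_pushforward__canonical__measure_function_Measure lambda mphi).
move=> /(_ _ B mB) ->// => X [[a b] _ <-] /=.
rewrite /pushforward (_ : phi @^-1` _ = `]a - c, b - c]%classic); last first.
  by apply/seteqP; split=> x /=; rewrite !in_itv/= /phi ltrBlDr lerBrDr.
by rewrite !lebesgue_measure_itv/= !lte_fin ltrD2r !EFinN -!EFinD; case: ifP => // _; congr EFin; ring.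
Qed.

Lemma gaussian1_translate a c v (B : set (measurableTypeR R)) : 0 <= v -> measurable B ->
  gaussian1 a v ((fun x => x + c) @^-1` B) = gaussian1 (a + c) v B.
Proof.
move=> v0 mB; pose phi : measurableTypeR R -> measurableTypeR R := fun x => x + c.
have mphi : measurable_fun setT phi by exact: measurable_funD.
rewrite /gaussian1; have [_|vn0] := eqVneq v 0.
  by rewrite !diracE; congr (_%:R%:E); apply/idP/idP; rewrite !inE.
have s0 : Num.sqrt v != 0 by rewrite gt_eqF// sqrtr_gt0 lt_def vn0.
rewrite /normal_prob.
transitivity (\int[pushforward lambda phi]_(x in B) (normal_pdf (a + c) (Num.sqrt v) x)%:E)%E.
  rewrite ge0_integral_pushforward//.
  - apply: eq_integral => x _ /=; congr EFin.
    by rewrite (normal_pdfE (a + c) s0) (normal_pdfE a s0) /normal_fun /phi opprD addrACA subrr addr0.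
  - by apply/measurable_EFinP; apply: measurable_funTS; exact: measurable_normal_pdf.
  - by move=> x _; rewrite lee_fin normal_pdf_ge0.
apply: eq_measure_integral => D mD _.
exact: lebesgue_measure_translate.
Qed.

End normal_moments.

(** With x = X z - a and y = X z' - a, expand (x - y)^4 and integrate first in z',
    then in z: the odd moments vanish, and 3 v^2 + 6 v v + 3 v^2 = 12 v^2 remains. *)
Lemma has_int2_gaussian4 {R : realType} d (T : measurableType d)
    (P : probability T R) (X : T -> measurableTypeR R) a v :
  measurable_fun setT X -> 0 <= v ->
  (forall B, measurable B -> P (X @^-1` B) = gaussian1 a v B) ->
  has_int2 P (fun z z' => (X z - X z') ^+ 4) (12 * v ^+ 2).
Proof.
move=> mX v0 law.
have M k : (k <= 4)%N -> has_int P (fun z => (X z - a) ^+ k) (gaussian_moment k v).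
  by move=> k4; exact: (has_int_gaussian1 mX v0 k4 law).
have M1 := M 1%N isT; have M2 := M 2%N isT; have M3 := M 3%N isT; have M4 := M 4%N isT.
exists (fun z => (X z - a) ^+ 4 + (6 * v * (X z - a) ^+ 2 + 3 * v ^+ 2)); split.
  move=> z; set w := X z - a.
  have := has_intD (has_int_cst P (w ^+ 4)) (has_intD (has_intZ (- 4 * w ^+ 3) M1)
    (has_intD (has_intZ (6 * w ^+ 2) M2) (has_intD (has_intZ (- 4 * w) M3) M4))).
  congr has_int; last by rewrite /gaussian_moment/=; ring.
  by apply/funext => z'; rewrite /w; ring.
have := has_intD M4 (has_intD (has_intZ (6 * v) M2) (has_int_cst P (3 * v ^+ 2))).
by congr has_int; rewrite /gaussian_moment/=; ring.
Qed.

(** * Gaussian laws on column vectors *)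

Section gaussian_vectors.
Context {R : realType}.

Lemma is_gaussian_eq d (P Q : set 'cV[R]_d -> \bar R) a S :
  (forall A, measurable A -> P A = Q A) -> is_gaussian P a S -> is_gaussian Q a S.
Proof.
move=> PQ [psdS law]; split=> // t B mB; rewrite -law// /pushforward PQ//.
by rewrite -[X in measurable X]setTI; exact: measurable_dotp.
Qed.

Lemma is_gaussian_covariance_inj d (P : probability 'cV[R]_d R) a S b U :
  is_gaussian P a S -> is_gaussian P b U -> S = U.
Proof.
move=> [[symS posS] lawS] [[symU posU] lawU]; apply: quad_inj => // t.
have [] := gaussian1_inj (measurable_dotp t) (posS t) (posU t) (lawS t) (lawU t).
by [].
Qed.

Lemma is_gaussian_affine p q (P : set 'cV[R]_p -> \bar R) a S
    (L : 'M[R]_(q, p)) (c : 'cV[R]_q) :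
  is_gaussian P a S ->
  is_gaussian (pushforward P (fun x => L *m x + c)) (L *m a + c) (L *m S *m L^T).
Proof.
move=> [psdS law]; split; first exact: psdmx_cong.
move=> t B mB; rewrite -/(quad _ t) quad_cong.
rewrite dotpDr -gaussian1_translate//; last exact: psdS.2.
have mB' : measurable ((fun x : measurableTypeR R => x + dotp t c) @^-1` B).
  rewrite -[X in measurable X]setTI.
  have mf : measurable_fun setT
      (fun x : measurableTypeR R => x + dotp t c : measurableTypeR R).
    exact: measurable_funD.
  exact: mf.
rewrite dotp_mulmx -law// /pushforward; congr (P _).
by apply/funext => x /=; rewrite dotpDr dotp_mulmx.
Qed.

Lemma is_gaussian_unique d (P Q : probability 'cV[R]_d R) a S :
  is_gaussian P a S -> is_gaussian Q a S -> forall A, measurable A -> P A = Q A.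
Proof.
by move=> [_ lawP] [_ lawQ]; apply: cramer_wold => t B mB; rewrite lawP// lawQ.
Qed.

End gaussian_vectors.

Lemma probability_pushforward {R : realType} d d' (T : measurableType d)
    (T' : measurableType d') (P : probability T R) (f : T -> T') :
  measurable_fun setT f ->
  exists Q : probability T' R, forall E, Q E = pushforward P f E.
Proof. by move=> mf; exists (distribution P (mfun_Sub (mem_set mf : f \in mfun))). Qed.

(** * The cost of a Gaussian coupling *)

Section cost.
Context {R : realType} {m n : nat}.
Local Notation stack := (fun z : 'cV[R]_m * 'cV[R]_n => col_mx z.1 z.2 : 'cV[R]_(m + n)).
Variables (pi : probability ('cV[R]_m * 'cV[R]_n)%type R) (a : 'cV[R]_(m + n))
  (S : 'M[R]_(m + n)).
Hypothesis gpi : is_gaussian (pushforward pi stack) a S.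

Let symS : S^T = S. Proof. by case: gpi => -[]. Qed.

(** Polarization: 12 x^2 y^2 = (x + y)^4 + (x - y)^4 - 2 (x^4 + y^4). *)
Lemma has_int2_gaussian_sqr2 i j :
  has_int2 pi (fun z z' => (stack z - stack z') i ord0 ^+ 2 * (stack z - stack z') j ord0 ^+ 2)
    (4 * S i i * S j j + 8 * S i j ^+ 2).
Proof.
have [[_ posS] law] := gpi.
have fourth t : has_int2 pi (fun z z' => dotp t (stack z - stack z') ^+ 4)
    (12 * quad S t ^+ 2).
  have := @has_int2_gaussian4 _ _ _ pi (dotp t \o stack) (dotp t a) (quad S t)
    (measurableT_comp (measurable_dotp t) (@measurable_col_mx R m n)) (posS t) (law t).
  by congr has_int2; apply/funext => z; apply/funext => z'; rewrite dotpDr dotpNr.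
have := has_int2Z 12^-1 (has_int2D
  (has_int2D (fourth (delta_mx i ord0 + 1 *: delta_mx j ord0))
             (fourth (delta_mx i ord0 + (-1) *: delta_mx j ord0)))
  (has_int2Z (-2) (has_int2D (fourth (delta_mx i ord0)) (fourth (delta_mx j ord0))))).
rewrite !quad_delta// !quad_delta1//.
congr has_int2; last by field.
apply/funext => z; apply/funext => z'; rewrite !dotpDl !dotpZl !dotp_delta.
by field.
Qed.

Definition gw_sign (i : 'I_(m + n)) : R := if fintype.split i is inl _ then 1 else -1.

Lemma gw_cost_gaussian : gw_cost pi =
  (4 * (\tr (ulsubmx S) - \tr (drsubmx S)) ^+ 2 +
   8 * (frobenius (ulsubmx S) ^+ 2 + frobenius (drsubmx S) ^+ 2
        - 2 * frobenius (ursubmx S) ^+ 2))%:E.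
Proof.
have gw_signl i : gw_sign (lshift n i) = 1 by rewrite /gw_sign (unsplitK (inl i)).
have gw_signr i : gw_sign (rshift m i) = -1 by rewrite /gw_sign (unsplitK (inr i)).
have := has_int2_integral (has_int2_sum (index_enum 'I_(m + n)) (fun i =>
  has_int2_sum (index_enum 'I_(m + n)) (fun j =>
    has_int2Z (gw_sign i * gw_sign j) (has_int2_gaussian_sqr2 i j)))).
rewrite /gw_cost => costE.
transitivity (\int[pi]_z \int[pi]_z' (\sum_i \sum_j gw_sign i * gw_sign j *
    ((stack z - stack z') i ord0 ^+ 2 * (stack z - stack z') j ord0 ^+ 2))%:E)%E.
  apply: eq_integral => z _; apply: eq_integral => z' _; congr EFin.
  have -> : enorm (z.1 - z'.1) ^+ 2 - enorm (z.2 - z'.2) ^+ 2 =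
      \sum_i gw_sign i * (stack z - stack z') i ord0 ^+ 2.
    rewrite !enorm_sqr big_split_ord -sumrN; congr (_ + _); apply: eq_bigr => i _.
      by rewrite gw_signl mul1r opp_col_mx add_col_mx col_mxEu.
    by rewrite gw_signr mulN1r opp_col_mx add_col_mx col_mxEd.
  rewrite expr2 mulr_suml; apply: eq_bigr => i _; rewrite mulr_sumr; apply: eq_bigr => j _.
  by rewrite mulrACA.
rewrite costE; congr EFin.
transitivity (4 * (\sum_i gw_sign i * S i i) ^+ 2 + 8 * \sum_i \sum_j gw_sign i * gw_sign j * S i j ^+ 2).
  rewrite expr2 mulr_suml !mulr_sumr -big_split; apply: eq_bigr => i _ /=.
  rewrite !mulr_sumr -big_split; apply: eq_bigr => j _ /=; ring.
congr (4 * _ ^+ 2 + 8 * _).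
  rewrite big_split_ord /= -sumrN; congr (_ + _); apply: eq_bigr => i _.
    by rewrite gw_signl mul1r !mxE.
  by rewrite gw_signr mulN1r !mxE.
rewrite !frobenius_sqr big_split_ord /=.
under eq_bigr => i _ do rewrite big_split_ord /=.
under [X in _ + X]eq_bigr => i _ do rewrite big_split_ord /=.
rewrite !big_split /=.
have -> : \sum_i \sum_j gw_sign (lshift n i) * gw_sign (lshift n j) * S (lshift n i) (lshift n j) ^+ 2 =
    \sum_i \sum_j ulsubmx S i j ^+ 2.
  by apply: eq_bigr => i _; apply: eq_bigr => j _; rewrite !gw_signl !mxE !mul1r.
have -> : \sum_i \sum_j gw_sign (rshift m i) * gw_sign (rshift m j) * S (rshift m i) (rshift m j) ^+ 2 =
    \sum_i \sum_j drsubmx S i j ^+ 2.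
  by apply: eq_bigr => i _; apply: eq_bigr => j _; rewrite !gw_signr !mxE mulrNN !mul1r.
have -> : \sum_i \sum_j gw_sign (lshift n i) * gw_sign (rshift m j) * S (lshift n i) (rshift m j) ^+ 2 =
    - \sum_i \sum_j ursubmx S i j ^+ 2.
  rewrite -sumrN; apply: eq_bigr => i _; rewrite -sumrN; apply: eq_bigr => j _.
  by rewrite gw_signl gw_signr !mxE mul1r mulN1r.
have -> : \sum_i \sum_j gw_sign (rshift m i) * gw_sign (lshift n j) * S (rshift m i) (lshift n j) ^+ 2 =
    - \sum_i \sum_j ursubmx S i j ^+ 2.
  rewrite exchange_big -sumrN; apply: eq_bigr => i _; rewrite -sumrN; apply: eq_bigr => j _.
  by rewrite gw_signl gw_signr mulr1 mulN1r -[in LHS]symS !mxE.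
by ring.
Qed.

Lemma gaussian_marginals (mu : probability 'cV[R]_m R) (nu : probability 'cV[R]_n R)
    m0 m1 S0 S1 :
  is_gaussian mu m0 S0 -> is_gaussian nu m1 S1 -> couplings mu nu pi ->
  ulsubmx S = S0 /\ drsubmx S = S1.
Proof.
move=> gmu gnu [pi1 pi2]; split.
  have -> : ulsubmx S = row_mx 1%:M 0 *m S *m (row_mx 1%:M 0)^T.
    rewrite -[in RHS](submxK S) mul_row_block tr_row_mx mul_row_col.
    by rewrite trmx1 trmx0 !mul1mx !mul0mx mulmx1 mulmx0 !addr0.
  apply: is_gaussian_covariance_inj gmu.
  apply: (is_gaussian_eq pi1).
  have := is_gaussian_affine (row_mx 1%:M 0) 0 gpi; congr is_gaussian.
  apply/funext => B; rewrite /pushforward; congr (pi _); apply/funext => z /=.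
  by rewrite mul_row_col mul1mx mul0mx !addr0.
have -> : drsubmx S = row_mx 0 1%:M *m S *m (row_mx 0 1%:M)^T.
  rewrite -[in RHS](submxK S) mul_row_block tr_row_mx mul_row_col.
  by rewrite trmx1 trmx0 !mul1mx !mul0mx mulmx1 mulmx0 !add0r.
apply: is_gaussian_covariance_inj gnu.
apply: (is_gaussian_eq pi2).
have := is_gaussian_affine (row_mx 0 1%:M) 0 gpi; congr is_gaussian.
apply/funext => B; rewrite /pushforward; congr (pi _); apply/funext => z /=.
by rewrite mul_row_col mul1mx mul0mx add0r addr0.
Qed.

End cost.

(** * The bound on the off-diagonal block *)

Section rearrangement.
Context {R : realType}.
Implicit Types (lam mu : nat -> R).

Lemma nonincreasing_nat_le (u : nat -> R) i j :
  (forall k, u k.+1 <= u k) -> (i <= j)%N -> u j <= u i.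
Proof.
move=> ndu /subnK <-; elim: (j - i)%N => [|k ih]; first by rewrite add0n.
exact: le_trans (ndu _) ih.
Qed.

(** Optimal dual potentials of the assignment problem with gains lam_i mu_j, for
    which the diagonal assignment is optimal. They are the discrete analogues of
    the integrals of mu d(-lam) and of lam d(-mu) over the indices beyond k, and
    their sum telescopes. *)
Lemma transport_potentials lam mu N :
  (forall k, lam k.+1 <= lam k) -> (forall k, mu k.+1 <= mu k) ->
  (forall k, 0 <= lam k) -> mu N = 0 ->
  exists u v : nat -> R,
    [/\ forall k, (k <= N)%N -> 0 <= u k /\ 0 <= v k,
        forall k, (k <= N)%N -> u k + v k = lam k * mu k &
        forall i j, (i <= N)%N -> (j <= N)%N -> lam i * mu j <= u i + v j].
Proof.
move=> ndl ndm l0 mN.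
have m0 k : (k <= N)%N -> 0 <= mu k by move=> kN; rewrite -mN; exact: nonincreasing_nat_le.
pose u k := \sum_(k <= l < N) mu l * (lam l - lam l.+1).
pose v k := \sum_(k <= l < N) lam l.+1 * (mu l - mu l.+1).
have uv k : (k <= N)%N -> u k + v k = lam k * mu k.
  move=> kN; rewrite /u /v -big_split /=.
  have E l : mu l * (lam l - lam l.+1) + lam l.+1 * (mu l - mu l.+1) =
      - (lam l.+1 * mu l.+1 - lam l * mu l) by ring.
  under eq_bigr do rewrite E.
  rewrite sumrN (telescope_sumr (fun l => lam l * mu l))// mN; ring.
(* Abel summation against a sequence b bounded below by its last value. *)
have step (a b : nat -> R) i j : (i <= j <= N)%N -> (forall k, a k.+1 <= a k) ->
    (forall l, (i <= l < j)%N -> b j <= b l) ->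
    b j * (a i - a j) <= \sum_(i <= l < j) b l * (a l - a l.+1).
  move=> /andP[ij jN] nda bj.
  rewrite -opprB -(telescope_sumr a ij) -sumrN mulr_sumr.
  rewrite [leLHS]big_nat [leRHS]big_nat; apply: ler_sum => l ilj.
  by rewrite opprB ler_wpM2r ?subr_ge0// bj.
exists u, v; split => //.
  move=> k kN; split; rewrite /u /v big_nat; apply: sumr_ge0 => l /andP[_ lN].
    by rewrite mulr_ge0 ?subr_ge0// m0// ltnW.
  by rewrite mulr_ge0// subr_ge0.
move=> i j iN jN; have [ij|/ltnW ji] := leqP i j.
  have -> : u i = \sum_(i <= l < j) mu l * (lam l - lam l.+1) + u j.
    by rewrite -big_cat_nat.
  have := @step lam mu i j; rewrite ij jN => /(_ isT ndl) h.
  have {}h := h (fun l lij => nonincreasing_nat_le ndm (ltnW (proj2 (andP lij)))).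
  by have := uv j jN; lra.
have -> : v j = \sum_(j <= l < i) lam l.+1 * (mu l - mu l.+1) + v i.
  by rewrite -big_cat_nat.
have h : lam i * (mu j - mu i) <= \sum_(j <= l < i) lam l.+1 * (mu l - mu l.+1).
  rewrite -opprB -(telescope_sumr mu ji) -sumrN mulr_sumr.
  rewrite [leLHS]big_nat [leRHS]big_nat; apply: ler_sum => l /andP[_ li].
  by rewrite opprB ler_wpM2r ?subr_ge0//; exact: nonincreasing_nat_le.
by have := uv i iN; lra.
Qed.

(** Weak duality: bound lam_i mu_j by u_i + v_j, then use that the rows and columns
    of s have sums at most 1. *)
Lemma substochastic_rearrangement m n (s : 'I_m -> 'I_n -> R) lam mu :
  (n <= m)%N ->
  (forall k, lam k.+1 <= lam k) -> (forall k, mu k.+1 <= mu k) ->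
  (forall k, 0 <= lam k) -> (forall k, (n <= k)%N -> mu k = 0) ->
  (forall i j, 0 <= s i j) ->
  (forall i, \sum_j s i j <= 1) -> (forall j, \sum_i s i j <= 1) ->
  \sum_(i < m) \sum_(j < n) lam i * mu j * s i j <= \sum_(k < n) lam k * mu k.
Proof.
move=> nm ndl ndm l0 muN s0 rows cols.
have [u [v [uv0 uvE uvle]]] := transport_potentials ndl ndm l0 (muN m nm).
have jm (j : 'I_n) : (j <= m)%N by rewrite (leq_trans _ nm)// ltnW.
have im (i : 'I_m) : (i <= m)%N by exact: ltnW.
apply: (@le_trans _ _ (\sum_(i < m) u i + \sum_(j < n) v j)).
  apply: (@le_trans _ _ (\sum_(i < m) \sum_(j < n) (u i * s i j + v j * s i j))).
    apply: ler_sum => i _; apply: ler_sum => j _.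
    by rewrite -mulrDl ler_wpM2r// uvle.
  under eq_bigr do rewrite big_split /=.
  rewrite big_split /= lerD//.
    apply: ler_sum => i _; rewrite -mulr_sumr -[leRHS]mulr1 ler_wpM2l//.
    by case: (uv0 i (im i)).
  rewrite exchange_big; apply: ler_sum => j _.
  rewrite -mulr_sumr -[leRHS]mulr1 ler_wpM2l//.
  by case: (uv0 j (jm j)).
have trunc (w : nat -> R) : (forall k, (n <= k < m)%N -> w k = 0) ->
    \sum_(i < m) w i = \sum_(j < n) w j.
  move=> w0; rewrite -(big_mkord xpredT) -(big_mkord xpredT w) (@big_cat_nat _ _ _ n)//=.
  by rewrite [X in _ + X]big_nat [X in _ + X]big1 ?addr0.
have -> : \sum_(i < m) u i = \sum_(j < n) u j.
  apply: trunc => k /andP[nk km]; have [u0 v0] := uv0 k (ltnW km).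
  by have := uvE k (ltnW km); rewrite muN// mulr0; lra.
by rewrite -big_split; apply: ler_sum => k _ /=; rewrite uvE.
Qed.

End rearrangement.

Section block_bound.
Context {R : realType}.

Lemma quad_diag d (D : 'M[R]_d) t : is_diag_mx D ->
  quad D t = \sum_i D i i * t i ord0 ^+ 2.
Proof.
move=> /is_diag_mxP dD; apply: eq_bigr => i _; rewrite mxE (bigD1 i)//= big1 ?addr0.
  by ring.
by move=> j ji; rewrite dD ?mul0r// eq_sym.
Qed.

Lemma quad_block p q (A : 'M[R]_p) (K : 'M[R]_(p, q)) (B : 'M[R]_q) x y :
  quad (block_mx A K K^T B) (col_mx x y) = quad A x + 2 * dotp x (K *m y) + quad B y.
Proof.
rewrite /quad mul_block_col dotp_col_mx !dotpDr (dotp_mulmx K^T) trmxK (dotpC (K *m y)).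
by ring.
Qed.

(** The test vector (x, - e_j) with x_i = K_ij / A_ii. When A_ii = 0, the
    convention 0^-1 = 0 drops the index i from both sides. *)
Lemma schur_diag p q (A : 'M[R]_p) (K : 'M[R]_(p, q)) (B : 'M[R]_q) j :
  is_diag_mx A -> B^T = B ->
  (forall x y, 0 <= quad A x + 2 * dotp x (K *m y) + quad B y) ->
  \sum_i K i j ^+ 2 / A i i <= B j j.
Proof.
move=> dA symB pos.
pose x : 'cV[R]_p := \col_i (K i j / A i i).
have := pos x (- delta_mx j ord0).
have -> : quad B (- delta_mx j ord0) = B j j.
  by rewrite /quad mulmxN dotpNl dotpNr opprK; exact: quad_delta1.
have -> : quad A x = \sum_i K i j ^+ 2 / A i i.
  rewrite quad_diag//; apply: eq_bigr => i _; rewrite mxE.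
  have [->|Ai] := eqVneq (A i i) 0; first by rewrite invr0 mul0r mulr0.
  by field.
have -> : dotp x (K *m - delta_mx j ord0) = - \sum_i K i j ^+ 2 / A i i.
  rewrite mulmxN dotpNr -colE; congr (- _); apply: eq_bigr => i _.
  by rewrite !mxE; ring.
by lra.
Qed.

(** Applied to the rows and to the columns, [schur_diag] makes s_ij = K_ij^2 / (lam_i mu_j)
    substochastic. *)
Lemma block_bound m n (nm : (n <= m)%N) (D0 : 'M[R]_m) (D1 : 'M[R]_n)
    (K : 'M[R]_(m, n)) :
  is_diag_mx D0 -> is_diag_mx D1 ->
  (forall i j : 'I_m, (i <= j)%N -> D0 j j <= D0 i i) ->
  (forall i j : 'I_n, (i <= j)%N -> D1 j j <= D1 i i) ->
  (forall i, 0 < D0 i i) -> psdmx (block_mx D0 K K^T D1) ->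
  \sum_i \sum_j K i j ^+ 2 <= \sum_(k < n) D0 (widen_ord nm k) (widen_ord nm k) * D1 k k.
Proof.
move=> d0 d1 nd0 nd1 D0pos [_ pos].
have posxy x y : 0 <= quad D0 x + 2 * dotp x (K *m y) + quad D1 y.
  by rewrite -quad_block; exact: pos.
have diagT d (D : 'M[R]_d) : is_diag_mx D -> D^T = D.
  by move=> /is_diag_mxP dD; apply/matrixP => i j; rewrite mxE; case: (eqVneq i j) => [->//|ij]; rewrite !dD// eq_sym.
have col j := schur_diag j d0 (diagT _ _ d1) posxy.
have row i : \sum_j K i j ^+ 2 / D1 j j <= D0 i i.
  have := @schur_diag n m D1 K^T D0 i d1 (diagT _ _ d0).
  under eq_bigr do rewrite mxE; apply => y x.
  rewrite (dotp_mulmx K^T) trmxK dotpC; have := posxy x y; lra.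
have D10 j : 0 <= D1 j j.
  by apply: le_trans (col j); apply: sumr_ge0 => i _; rewrite divr_ge0 ?sqr_ge0 ?ltW.
pose s i j := K i j ^+ 2 / (D0 i i * D1 j j).
(* The diagonals, continued by 0 to decreasing sequences. *)
pose ext d (D : 'M[R]_d) k := if insub k is Some i then D i i else 0.
have extE d (D : 'M[R]_d) (i : 'I_d) : ext d D i = D i i by rewrite /ext valK.
have ext0 d (D : 'M[R]_d) k : (d <= k)%N -> ext d D k = 0.
  by move=> dk; rewrite /ext insubF// ltnNge dk.
have ext_nd d (D : 'M[R]_d) : (forall i j : 'I_d, (i <= j)%N -> D j j <= D i i) ->
    (forall i, 0 <= D i i) -> forall k, ext d D k.+1 <= ext d D k.
  move=> ndD pD k; have [dk|kd] := leqP d k.+1.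
    by rewrite (ext0 _ _ k.+1)// /ext; case: insubP.
  have := ndD (Ordinal (ltnW kd)) (Ordinal kd) (leqnSn k).
  by rewrite -!extE.
have D00 i : 0 <= D0 i i by exact: ltW.
have := @substochastic_rearrangement R m n s (ext m D0) (ext n D1) nm
  (ext_nd _ _ nd0 D00) (ext_nd _ _ nd1 D10).
have e0 k : 0 <= ext m D0 k by rewrite /ext; case: insubP.
move=> /(_ e0 (ext0 _ _)) h.
have -> : \sum_i \sum_j K i j ^+ 2 =
    \sum_(i < m) \sum_(j < n) ext m D0 i * ext n D1 j * s i j.
  apply: eq_bigr => i _; apply: eq_bigr => j _; rewrite !extE /s.
  have [D1j|D1j] := eqVneq (D1 j j) 0; last first.
    by field; rewrite D1j gt_eqF.
  (* A zero eigenvalue mu_j forces the whole column j of K to vanish. *)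
  have := col j; rewrite D1j (bigD1 i)//= => le0.
  have Ki : K i j ^+ 2 / D0 i i <= 0.
    apply: le_trans le0; rewrite lerDl; apply: sumr_ge0 => l _.
    by rewrite divr_ge0 ?sqr_ge0.
  move: Ki; rewrite ler_pdivrMr// mul0r => Ki; rewrite mulr0 mul0r.
  by apply/eqP; rewrite eq_le Ki sqr_ge0.
have -> : \sum_(k < n) D0 (widen_ord nm k) (widen_ord nm k) * D1 k k =
    \sum_(k < n) ext m D0 k * ext n D1 k.
  by apply: eq_bigr => k _; rewrite -(extE _ D0) -(extE _ D1).
apply: h.
- by move=> i j; rewrite divr_ge0 ?sqr_ge0// mulr_ge0.
- move=> i; rewrite -(divff (lt0r_neq0 (D0pos i))).
  rewrite ler_pdivlMr// mulr_suml; apply: le_trans (row i).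
  apply: ler_sum => j _; rewrite le_eqVlt; apply/orP; left; apply/eqP; rewrite /s.
  have [->|D1j] := eqVneq (D1 j j) 0; first by rewrite mulr0 invr0 !mulr0 mul0r.
  by field; rewrite D1j gt_eqF.
- move=> j; have [D1j|D1j] := eqVneq (D1 j j) 0.
    by rewrite big1 ?ler01// => i _; rewrite /s D1j mulr0 invr0 mulr0.
  rewrite -(divff D1j) ler_pdivlMr ?lt_def ?D1j ?D10// mulr_suml.
  apply: le_trans (col j); apply: ler_sum => i _; rewrite /s.
  by rewrite le_eqVlt; apply/orP; left; apply/eqP; field; rewrite D1j gt_eqF.
Qed.

End block_bound.

(** * The square root and the optimal linear map *)

Section matrix_sqrt.
Context {R : realType}.

Lemma sym_sqr0 d (M : 'M[R]_d) : M^T = M -> M *m M = 0 -> M = 0.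
Proof.
move=> symM MM; apply/matrixP => i j; rewrite mxE.
have Mt k l : M l k = M k l by rewrite -{1}symM mxE.
have /matrixP/(_ i i) := MM; rewrite !mxE => /eqP.
rewrite psumr_eq0 => [/allP/(_ j (mem_index_enum _))|k _].
  by rewrite (Mt i j) /= mulf_eq0 orbb => /eqP.
by rewrite (Mt i k) -expr2 sqr_ge0.
Qed.

Lemma psd_diag_sqrt d (D : 'M[R]_d) : (forall i, 0 <= D i i) ->
  psdmx (diag_mx (\row_i Num.sqrt (D i i))).
Proof.
move=> D0; split; first exact: tr_diag_mx.
move=> x; rewrite -/(quad _ x) quad_diag ?diag_mx_is_diag//.
by apply: sumr_ge0 => i _; rewrite !mxE eqxx mulr1n mulr_ge0 ?sqrtr_ge0 ?sqr_ge0.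
Qed.

Lemma diag_mx_mul d (a b : 'I_d -> R) :
  diag_mx (\row_i a i) *m diag_mx (\row_i b i) = diag_mx (\row_i (a i * b i)).
Proof.
apply/matrixP => i j; rewrite mul_diag_mx !mxE.
by case: (eqVneq i j) => [->|_]; rewrite ?mulr1n// !mulr0n mulr0.
Qed.

(** Uniqueness of the positive semi-definite square root of a diagonal matrix D.
    A root S commutes with D, so S_ij = 0 unless D_ii = D_jj, and therefore S
    commutes with the diagonal root T. Then N = S - T satisfies (S + T) N = 0;
    since S and T are both positive, the quadratic forms of S and T vanish on the
    range of N, so N^3 = 0 and the symmetric matrix N is 0. *)
Lemma sqrtmx_diag d (D : 'M[R]_d) : is_diag_mx D -> (forall i, 0 <= D i i) ->
  sqrtmx D = diag_mx (\row_i Num.sqrt (D i i)).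
Proof.
move=> dD D0; set T := diag_mx _.
have psdT : psdmx T by exact: psd_diag_sqrt.
have TT : T *m T = D.
  rewrite diag_mx_mul; apply/matrixP => i j; rewrite !mxE.
  have [<-|ij] := eqVneq i j; first by rewrite mulr1n -expr2 sqr_sqrtr.
  by rewrite mulr0n (is_diag_mxP dD).
have [psdS SS] : psdmx (sqrtmx D) /\ sqrtmx D *m sqrtmx D = D.
  exact: (@xgetPex _ 0 [set S | psdmx S /\ S *m S = D] (ex_intro _ T (conj psdT TT))).
move: (sqrtmx D) psdS SS => S [symS posS] SS.
have [symT posT] := psdT.
have comST : S *m T = T *m S.
  have : S *m D = D *m S by rewrite -SS mulmxA.
  move=> /matrixP SD; apply/matrixP => i j.
  have := SD i j; rewrite mul_mx_diag mul_diag_mx !mxE.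
  rewrite (bigD1 j)//= [X in _ + X]big1 => [|k kj]; last first.
    by rewrite (is_diag_mxP dD) ?mulr0.
  rewrite (bigD1 i)//= [X in _ = _ + X]big1 => [|k ki]; last first.
    by rewrite (is_diag_mxP dD) ?mul0r// eq_sym.
  rewrite !addr0 mulrC => /eqP.
  rewrite -subr_eq0 -mulrBl mulf_eq0 subr_eq0 => /orP[/eqP->|/eqP->].
    by rewrite mulrC.
  by rewrite mul0r mulr0.
pose N := S - T.
have symN : N^T = N by rewrite /N linearB /= symS symT.
have STN : (S + T) *m N = 0.
  by rewrite /N mulmxDl !mulmxBr SS TT comST addrA subrK subrr.
have N3 : N *m N *m N = 0.
  apply: quad_inj; [by rewrite !trmx_mul symN mulmxA|by rewrite trmx0|move=> x].
  rewrite {2}/quad mul0mx dotp0r.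
  have := quad_cong N N x; rewrite symN => ->.
  have : quad (S + T) (N *m x) = 0.
    by rewrite /quad mulmxA STN mul0mx dotp0r.
  have := posS (N *m x); have := posT (N *m x); move: (N *m x) => y.
  by rewrite /quad /N mulmxBl mulmxDl !dotpDr dotpNr; lra.
have N2 : N *m N = 0.
  by apply: sym_sqr0; [rewrite trmx_mul symN|rewrite mulmxA N3 mul0mx].
by have /eqP := sym_sqr0 symN N2; rewrite subr_eq0 => /eqP.
Qed.

End matrix_sqrt.

Section diagonal_form.
Context {R : realType}.

Lemma orthogonalmxC d (P : 'M[R]_d) : orthogonalmx P -> P *m P^T = 1%:M.
Proof. exact: mulmx1C. Qed.

Lemma frobenius_orthogonal p q (P : 'M[R]_p) (Q : 'M[R]_q) (M : 'M[R]_(p, q)) :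
  orthogonalmx P -> orthogonalmx Q -> frobenius (P *m M *m Q^T) ^+ 2 = frobenius M ^+ 2.
Proof.
move=> oP oQ; rewrite !frobenius_tr !trmx_mul trmxK.
rewrite -!mulmxA (mulmxA P^T) oP mul1mx mxtrace_mulC.
by rewrite -!mulmxA oQ mulmx1.
Qed.

Lemma mxtrace_orthogonal d (P D : 'M[R]_d) : orthogonalmx P -> \tr (P *m D *m P^T) = \tr D.
Proof. by move=> oP; rewrite mxtrace_mulC mulmxA oP mul1mx. Qed.

Lemma frobenius_diag d (D : 'M[R]_d) : is_diag_mx D ->
  frobenius D ^+ 2 = \sum_i D i i ^+ 2.
Proof.
move=> /is_diag_mxP dD; rewrite frobenius_sqr; apply: eq_bigr => i _.
rewrite (bigD1 i)//= big1 ?addr0// => j ji.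
by rewrite dD ?expr0n// eq_sym.
Qed.

Lemma diagonalization_ge0 d (S P D : 'M[R]_d) :
  psdmx S -> sorted_diagonalization S P D -> forall i, 0 <= D i i.
Proof.
move=> psdS [oP dD _ SE] i.
have -> : D = P^T *m S *m P^T^T.
  by rewrite SE trmxK -!mulmxA oP mulmx1 !mulmxA oP mul1mx.
by have [symD] := psdmx_cong P^T psdS => /(_ (delta_mx i ord0)); rewrite -/(quad _ _) quad_delta1.
Qed.

Lemma diagonalization_gt0 d (S P D : 'M[R]_d) :
  psdmx S -> S \in unitmx -> sorted_diagonalization S P D -> forall i, 0 < D i i.
Proof.
move=> psdS uS sdS i; have D0 := diagonalization_ge0 psdS sdS i.
have [oP /is_diag_mxP dD _ SE] := sdS.
rewrite lt_def D0 andbT; apply/eqP => Di.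
have uD : D \in unitmx.
  by move: uS; rewrite SE !unitmx_mul => /andP[/andP[]].
have : invmx D *m (D *m delta_mx i ord0) = delta_mx i (ord0 : 'I_1) by rewrite mulKmx.
rewrite -colE; have -> : col i D = 0.
  apply/matrixP => k l; rewrite !mxE; have [->//|ki] := eqVneq k i; exact: dD.
by rewrite mulmx0 => /matrixP/(_ i ord0)/eqP; rewrite !mxE !eqxx eq_sym oner_eq0.
Qed.

Lemma invmx_diag d (a : 'I_d -> R) : (forall i, a i != 0) ->
  invmx (diag_mx (\row_i a i)) = diag_mx (\row_i (a i)^-1).
Proof.
move=> a0; set A := diag_mx _; set B := diag_mx _.
have AB : A *m B = 1%:M.
  rewrite diag_mx_mul; apply/matrixP => i j; rewrite !mxE.
  have [_|_] := eqVneq i j; first by rewrite divff.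
  by rewrite mulr0n.
have [uA _] := mulmx1_unit AB.
by rewrite -[LHS]mulmx1 -AB mulKmx.
Qed.

Lemma gw_matrixE m n (nm : (n <= m)%N) eps (D0 : 'M[R]_m) (D1 : 'M[R]_n) i j :
  is_diag_mx D0 -> is_diag_mx D1 -> (forall i, 0 < D0 i i) -> (forall i, 0 <= D1 i i) ->
  gw_matrix nm eps D0 D1 i j =
  if j == widen_ord nm i then
    (-1) ^+ eps i * Num.sqrt (D1 i i) / Num.sqrt (D0 (widen_ord nm i) (widen_ord nm i))
  else 0.
Proof.
move=> d0 d1 D0pos D10.
have dL : is_diag_mx (leading nm D0).
  apply/is_diag_mxP => k l kl; rewrite mxE; apply: (is_diag_mxP d0).
  by [].
have L0 k : 0 <= leading nm D0 k k by rewrite mxE ltW.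
rewrite /gw_matrix !sqrtmx_diag// invmx_diag => [|k]; last first.
  by rewrite mxE gt_eqF// sqrtr_gt0.
rewrite /signmx !diag_mx_mul castmxE /= cast_ord_id.
set j' := cast_ord _ j.
have jj' : nat_of_ord j' = nat_of_ord j by [].
case: (split_ordP j') => k jk.
  have jk' : nat_of_ord j = k by rewrite -jj' jk.
  rewrite jk row_mxEl !mxE.
  have -> : (j == widen_ord nm i) = (i == k) by rewrite -!val_eqE /= jk' eq_sym.
  by case: eqVneq => _; rewrite ?mulr1n ?mulr0n.
rewrite jk row_mxEr mxE ifF//; apply/negP => /eqP jw.
have : nat_of_ord j = (n + k)%N by rewrite -jj' jk.
by rewrite jw /= => ik; have := ltn_ord i; rewrite ik ltnNge leq_addr.
Qed.

(** The first equality makes the linear map send covariance D0 to covariance D1; the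
    second says that it attains the bound of [block_bound]. *)
Lemma gw_matrix_entries m n (nm : (n <= m)%N) eps (D0 : 'M[R]_m) (D1 : 'M[R]_n) :
  is_diag_mx D0 -> is_diag_mx D1 -> (forall i, 0 < D0 i i) -> (forall i, 0 <= D1 i i) ->
  let A := gw_matrix nm eps D0 D1 in
  A *m D0 *m A^T = D1 /\
  frobenius (D0 *m A^T) ^+ 2 =
    \sum_(k < n) D0 (widen_ord nm k) (widen_ord nm k) * D1 k k.
Proof.
move=> d0 d1 D0pos D10 A.
pose w := widen_ord nm; have winj : injective w by move=> k l /(congr1 val) /= /val_inj.
(* The row k has at most one nonzero entry, a k in column k. *)
pose a k := (-1) ^+ eps k * Num.sqrt (D1 k k) / Num.sqrt (D0 (w k) (w k)).
have AE i j : A i j = if j == w i then a i else 0 by exact: gw_matrixE.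
have aa k : a k ^+ 2 * D0 (w k) (w k) = D1 k k.
  rewrite /a !exprMn sqrr_sign mul1r exprVn !sqr_sqrtr ?(ltW (D0pos _))//.
  by rewrite divfK// gt_eqF.
have AD i j : (A *m D0) i j = A i j * D0 j j.
  rewrite mxE (bigD1 j)//= big1 ?addr0// => k kj.
  by rewrite (is_diag_mxP d0) ?mulr0.
split.
  apply/matrixP => i j; rewrite mxE (bigD1 (w i))//= big1 => [|k ki]; last first.
    by rewrite AD AE (negbTE ki) !mul0r.
  rewrite addr0 AD mxE !AE eqxx (inj_eq winj).
  have [<-|ij] := eqVneq i j; first by rewrite mulrAC -expr2 aa.
  by rewrite mulr0 (is_diag_mxP d1).
have dT : D0^T = D0.
  apply/matrixP => i j; rewrite mxE; have [->//|ij] := eqVneq i j.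
  by rewrite !(is_diag_mxP d0)// eq_sym.
have -> : D0 *m A^T = (A *m D0)^T by rewrite trmx_mul dT.
rewrite frobenius_sqr exchange_big; apply: eq_bigr => i _.
rewrite (bigD1 (w i))//= big1 => [|k ki]; last first.
  by rewrite mxE AD AE (negbTE ki) mul0r expr0n.
by rewrite addr0 mxE AD AE eqxx exprMn -aa; ring.
Qed.

Lemma gw_valueE m n (nm : (n <= m)%N) (D0 : 'M[R]_m) (D1 : 'M[R]_n) :
  is_diag_mx D0 -> is_diag_mx D1 ->
  4 * (\tr D0 - \tr D1) ^+ 2 + 8 * frobenius (leading nm D0 - D1) ^+ 2
    + 8 * (frobenius D0 ^+ 2 - frobenius (leading nm D0) ^+ 2) =
  4 * (\tr D0 - \tr D1) ^+ 2 + 8 * (frobenius D0 ^+ 2 + frobenius D1 ^+ 2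
    - 2 * \sum_(k < n) D0 (widen_ord nm k) (widen_ord nm k) * D1 k k).
Proof.
move=> d0 d1.
have dL : is_diag_mx (leading nm D0).
  by apply/is_diag_mxP => k l kl; rewrite mxE; apply: (is_diag_mxP d0).
have dB : is_diag_mx (leading nm D0 - D1).
  by apply/is_diag_mxP => k l kl; rewrite !mxE !(is_diag_mxP d0, is_diag_mxP d1)// subr0.
have -> : frobenius (leading nm D0 - D1) ^+ 2 = frobenius (leading nm D0) ^+ 2
    + frobenius D1 ^+ 2 - 2 * \sum_(k < n) D0 (widen_ord nm k) (widen_ord nm k) * D1 k k.
  rewrite !frobenius_diag// mulr_sumr -sumrN -!big_split; apply: eq_bigr => k _ /=.
  by rewrite !mxE; ring.
by ring.
Qed.

End diagonal_form.

(** * Optimal Gaussian couplings *)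

Section optimality.
Context {R : realType} {m n : nat} (nm : (n <= m)%N).
Variables (mu : probability 'cV[R]_m R) (nu : probability 'cV[R]_n R)
  (m0 : 'cV[R]_m) (m1 : 'cV[R]_n) (S0 P0 D0 : 'M[R]_m) (S1 P1 D1 : 'M[R]_n).
Hypotheses (gmu : is_gaussian mu m0 S0) (gnu : is_gaussian nu m1 S1)
  (sd0 : sorted_diagonalization S0 P0 D0) (sd1 : sorted_diagonalization S1 P1 D1)
  (S0unit : S0 \in unitmx).

Let D0pos : forall i, 0 < D0 i i := diagonalization_gt0 gmu.1 S0unit sd0.
Let D1ge0 : forall i, 0 <= D1 i i := diagonalization_ge0 gnu.1 sd1.
Let oP0 : orthogonalmx P0. Proof. by case: sd0. Qed.
Let oP1 : orthogonalmx P1. Proof. by case: sd1. Qed.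
Let d0 : is_diag_mx D0. Proof. by case: sd0. Qed.
Let d1 : is_diag_mx D1. Proof. by case: sd1. Qed.
Let S0E : S0 = P0 *m D0 *m P0^T. Proof. by case: sd0. Qed.
Let S1E : S1 = P1 *m D1 *m P1^T. Proof. by case: sd1. Qed.

Let c := \sum_(k < n) D0 (widen_ord nm k) (widen_ord nm k) * D1 k k.

Let value := 4 * (\tr D0 - \tr D1) ^+ 2
     + 8 * frobenius (leading nm D0 - D1) ^+ 2
     + 8 * (frobenius D0 ^+ 2 - frobenius (leading nm D0) ^+ 2).

Lemma gw_cost_coupling (pi : probability ('cV[R]_m * 'cV[R]_n)%type R) a S :
  couplings mu nu pi ->
  is_gaussian (pushforward pi (fun z => col_mx z.1 z.2 : 'cV[R]_(m + n))) a S ->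
  gw_cost pi = (value + 16 * (c - frobenius (ursubmx S) ^+ 2))%:E.
Proof.
move=> cpi gpi; have [ulS drS] := gaussian_marginals gpi gmu gnu cpi.
rewrite (gw_cost_gaussian gpi) ulS drS /value gw_valueE// -/c.
rewrite {1}S0E {1}S1E !mxtrace_orthogonal//.
rewrite [in X in 8 * (X + _ - _)]S0E [in X in 8 * (_ + X - _)]S1E.
rewrite !frobenius_orthogonal//; congr EFin; ring.
Qed.

(** Rotating both factors makes the diagonal blocks diagonal and preserves
    positivity as well as the Frobenius norm of the off-diagonal block. *)
Lemma coupling_covariance_bound (S : 'M[R]_(m + n)) : psdmx S ->
  ulsubmx S = S0 -> drsubmx S = S1 -> frobenius (ursubmx S) ^+ 2 <= c.
Proof.
move=> psdS ulS drS; set K := ursubmx S.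
have SE : S = block_mx S0 K K^T S1.
  rewrite -[LHS]submxK ulS drS; congr block_mx.
  by rewrite -[in LHS]psdS.1; apply/matrixP => i j; rewrite !mxE.
have oP0T : orthogonalmx P0^T by rewrite /orthogonalmx trmxK; exact: orthogonalmxC.
have oP1T : orthogonalmx P1^T by rewrite /orthogonalmx trmxK; exact: orthogonalmxC.
rewrite -(frobenius_orthogonal K oP0T oP1T) trmxK frobenius_sqr.
case: sd0 sd1 => [_ _ nd0 _] [_ _ nd1 _].
apply: block_bound => //.
have := psdmx_cong (block_mx P0^T 0 0 P1^T) psdS.
rewrite SE tr_block_mx !trmx0 !trmxK !mulmx_block.
rewrite !mul0mx !mulmx0 !addr0 !add0r {1}S0E {1}S1E.
congr psdmx; congr block_mx.
- by rewrite -!mulmxA oP0 mulmx1 !mulmxA oP0 mul1mx.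
- by rewrite !trmx_mul trmxK mulmxA.
- by rewrite -!mulmxA oP1 mulmx1 !mulmxA oP1 mul1mx.
Qed.

Lemma gw_cost_ge (pi : probability ('cV[R]_m * 'cV[R]_n)%type R) :
  (couplings mu nu `&` @gaussians R m n) pi -> (value%:E <= gw_cost pi)%E.
Proof.
move=> [cpi [a [S gpi]]].
have [ulS drS] := gaussian_marginals gpi gmu gnu cpi.
rewrite (gw_cost_coupling cpi gpi) lee_fin lerDl mulr_ge0// subr_ge0.
exact: coupling_covariance_bound gpi.1 ulS drS.
Qed.

(** The law of (x, T x) is Gaussian with off-diagonal block P0 (D0 A^T) P1^T, whose
    Frobenius norm is extremal by [gw_matrix_entries]. *)
Lemma gw_affine_optimal (eps : 'I_n -> bool) :
  let T := fun x : 'cV[R]_m => m1 + P1 *m gw_matrix nm eps D0 D1 *m P0^T *m (x - m0) in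
  exists pi : probability ('cV[R]_m * 'cV[R]_n)%type R,
    [/\ forall E, measurable E -> pi E = pushforward mu (fun x => (x, T x)) E,
        (couplings mu nu `&` @gaussians R m n) pi &
        gw_cost pi = value%:E].
Proof.
move=> T; pose A := gw_matrix nm eps D0 D1.
have [ADA DA] := gw_matrix_entries nm eps d0 d1 D0pos D1ge0.
pose L := P1 *m A *m P0^T; pose b := m1 - L *m m0.
have TE x : T x = L *m x + b by rewrite /T /b mulmxBr addrCA addrA.
have Lb : L *m m0 + b = m1 by rewrite /b addrC subrK.
have LSL : L *m S0 *m L^T = S1.
  rewrite /L S0E S1E !trmx_mul trmxK -ADA -/A.
  rewrite -!mulmxA (mulmxA P0^T P0) oP0 mul1mx (mulmxA P0^T P0) oP0 mul1mx.
  by [].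
have mT : measurable_fun setT T.
  rewrite (_ : T = fun x => L *m x + b); last exact/funext.
  by apply: measurable_mxD => //; exact: measurable_mulmx.
have [pi piE] := probability_pushforward mu (measurable_fun_pair (@measurable_id _ _ setT) mT).
have gjoint : is_gaussian (pushforward pi (fun z => col_mx z.1 z.2 : 'cV[R]_(m + n)))
    (col_mx 1%:M L *m m0 + col_mx 0 b) (col_mx 1%:M L *m S0 *m (col_mx 1%:M L)^T).
  have := is_gaussian_affine (col_mx 1%:M L) (col_mx 0 b) gmu.
  congr is_gaussian; apply/funext => B; rewrite /pushforward piE /pushforward; congr (mu _).
  by apply/funext => x /=; rewrite mul_col_mx mul1mx add_col_mx addr0 TE.
have cpi : couplings mu nu pi.
  split=> B mB; rewrite /pushforward piE//.
  have [nuT nuTE] := probability_pushforward mu mT.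
  rewrite -[LHS]/(pushforward mu T B) -nuTE; apply: (is_gaussian_unique _ gnu) mB.
  have := is_gaussian_affine L b gmu; rewrite LSL Lb; apply: is_gaussian_eq => E _.
  by rewrite nuTE (_ : T = fun x => L *m x + b)//; exact/funext.
exists pi; split => //.
- by split=> //; exists (col_mx 1%:M L *m m0 + col_mx 0 b), (col_mx 1%:M L *m S0 *m (col_mx 1%:M L)^T).
- rewrite (gw_cost_coupling cpi gjoint) (_ : ursubmx _ = P0 *m (D0 *m A^T) *m P1^T).
    by rewrite frobenius_orthogonal// DA subrr mulr0 addr0.
  rewrite tr_col_mx trmx1 mul_col_mx mul1mx mul_col_row block_mxKur.
  by rewrite /L S0E !trmx_mul trmxK -!mulmxA (mulmxA P0^T P0) oP0 mul1mx.
Qed.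

End optimality.

Theorem theorem4p1 (R : realType) (m n : nat) (hnm : (n <= m)%N)
    (mu : probability 'cV[R]_m R) (nu : probability 'cV[R]_n R)
    (m0 : 'cV[R]_m) (m1 : 'cV[R]_n)
    (Sigma0 P0 D0 : 'M[R]_m) (Sigma1 P1 D1 : 'M[R]_n)
    (hmu : is_gaussian mu m0 Sigma0) (hnu : is_gaussian nu m1 Sigma1)
    (hdiag0 : sorted_diagonalization Sigma0 P0 D0)
    (hdiag1 : sorted_diagonalization Sigma1 P1 D1)
    (hSigma0 : Sigma0 \in unitmx) :
  (forall eps : 'I_n -> bool,
    let A := gw_matrix hnm eps D0 D1 in
    let T := fun x : 'cV[R]_m => m1 + P1 *m A *m P0^T *m (x - m0) in
    exists pi : probability ('cV[R]_m * 'cV[R]_n)%type R,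
      [/\ forall E, measurable E ->
            pi E = pushforward mu (fun x => (x, T x)) E,
          (couplings mu nu `&` @gaussians R m n) pi &
          gw_cost pi = GGW2_sq mu nu]) /\
  GGW2_sq mu nu =
    (4 * (\tr D0 - \tr D1) ^+ 2
     + 8 * frobenius (leading hnm D0 - D1) ^+ 2
     + 8 * (frobenius D0 ^+ 2 - frobenius (leading hnm D0) ^+ 2))%:E.
Proof.
have opt := gw_affine_optimal hnm hmu hnu hdiag0 hdiag1 hSigma0.
have ggwE : GGW2_sq mu nu =
    (4 * (\tr D0 - \tr D1) ^+ 2
     + 8 * frobenius (leading hnm D0 - D1) ^+ 2
     + 8 * (frobenius D0 ^+ 2 - frobenius (leading hnm D0) ^+ 2))%:E.
  apply/eqP; rewrite eq_le; apply/andP; split.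
    have [pi [_ cpi <-]] := opt (fun=> false).
    by apply: ereal_inf_lbound; exists pi.
  apply: le_ereal_inf_tmp => _ [pi cpi <-].
  exact: (gw_cost_ge hnm hmu hnu hdiag0 hdiag1 hSigma0 cpi).
split=> // eps A T; rewrite ggwE; exact: opt.
Qed.
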